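(* There exists an absolute constant $K>0$ such that every graph $G$ with maximum degree $\Delta \ge 2$ satisfies $$\operatorname{fla}(G) \le \frac{\Delta}{2} + K\log \Delta .$$
   Context: Graphs are finite and simple. A linear forest is a collection of vertex-disjoint paths (a single vertex counts as a path). The fractional linear arboricity $\operatorname{fla}(G)$ of a graph $G$ (with at least one edge) is the smallest real number $k>0$ for which there is a probability distribution on the linear forests of $G$ (linear forests that are subgraphs of $G$) such that, for a random linear forest $F$ chosen from this distribution, every fixed edge $e\in E(G)$ satisfies $\Pr(e \in E(F)) \ge 1/k$. $\log$ is the natural logarithm. *)

(* Defs.v *)
From HB Require Import structures.
From mathcomp Require Import all_boot all_order all_algebra.
From mathcomp Require Import all_classical all_reals all_analysis.
Import Order.TTheory GRing.Theory Num.Theory.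
Import numFieldNormedType.Exports.

Set Implicit Arguments.
Unset Strict Implicit.
Unset Printing Implicit Defensive.

Local Open Scope set_scope.
Local Open Scope ring_scope.

Record sgraph := SGraph {
  vertex :> finType;
  adj : rel vertex;
  adj_sym : symmetric adj;
  adj_irrefl : irreflexive adj }.

Definition edges (G : sgraph) : {set {set G}} :=
  [set [set xy.1; xy.2] | xy : G * G & adj xy.1 xy.2].

Definition max_degree (G : sgraph) : nat :=
  (\max_(x : G) #|[set y : G | adj x y]|)%N.

(* A subgraph is encoded by its vertex set and its edge set. *)
Notation subgraph G := ({set G} * {set {set G}})%type.

(* A path is encoded by the sequence of its successive vertices. *)
Definition path_edges (G : sgraph) (p : seq G) : {set {set G}} :=
  [set [set xy.1; xy.2] | xy in zip p (behead p)].

(* Uniqueness of [flatten ps] says that each member of [ps] repeats no vertex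
   and that distinct members share none. *)
Definition linear_forest (G : sgraph) (F : subgraph G) : Prop :=
  exists ps : seq (seq G),
    [/\ all (fun p => (p != [::]) && sorted (@adj G) p) ps,
        uniq (flatten ps),
        F.1 = [set x in flatten ps] &
        F.2 = \bigcup_(p <- ps) path_edges p].

Definition linear_forest_dist (R : realType) (G : sgraph)
    (mu : subgraph G -> R) : Prop :=
  [/\ forall F, 0 <= mu F,
      \sum_F mu F = 1 &
      forall F, mu F != 0 -> linear_forest F].

Definition edge_prob (R : realType) (G : sgraph) (mu : subgraph G -> R)
    (e : {set G}) : R :=
  \sum_(F : subgraph G | e \in F.2) mu F.

Definition fla_admissible (R : realType) (G : sgraph) : set R :=
  [set k | 0 < k /\ exists mu : subgraph G -> R,
     linear_forest_dist mu /\
     forall e, e \in edges G -> k^-1 <= edge_prob mu e]%classic.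
Arguments fla_admissible : clear implicits.

(* The infimum is a minimum whenever [G] has an edge: see [fla_min]. *)
Definition fla (R : realType) (G : sgraph) : R := inf (fla_admissible R G).

Section Attained.
Local Open Scope classical_set_scope.
Variables (R : realType) (G : sgraph).

Lemma single_edge_linear_forest (x y : G) :
  adj x y -> linear_forest ([set x; y], [set [set x; y]])%SET.
Proof.
move=> xy; exists [:: [:: x; y]]; split => /=.
- by rewrite xy.
- rewrite inE andbT; apply/negP => /eqP exy.
  by move: xy; rewrite exy adj_irrefl.
- by apply/setP => z; rewrite !inE.
- rewrite big_seq1; apply/setP => e; rewrite inE.
  apply/eqP/imsetP => [->|[u]]; first by exists (x, y); rewrite //= inE.
  by rewrite /= inE => /eqP -> ->.
Qed.

Lemma fla_admissible_neq0 : edges G != finset.set0 ->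
  fla_admissible R G !=set0.
Proof.
move=> E0; set m := #|edges G|.
have m0 : 0 < m%:R :> R by rewrite ltr0n card_gt0.
pose h (e : {set G}) : subgraph G := (e, [set e])%SET.
have hinj : injective h by move=> e e' [].
exists m%:R; split=> //.
exists (fun F => if F \in h @: edges G then m%:R^-1 else 0); split.
  split=> [F|| F].
  - by case: ifP => // _; rewrite invr_ge0 ltW.
  - rewrite -big_mkcond /= sumr_const card_imset // -/m -[LHS]mulr_natr mulVf //.
    by rewrite gt_eqF.
  - case: ifP => [/imsetP[e /imsetP[[x y]]]|]; last by rewrite eqxx.
    rewrite inE /= => xy -> -> _; exact: single_edge_linear_forest.
move=> e eE; rewrite /edge_prob (bigD1 (h e)) /=; last by rewrite inE.
rewrite imset_f // lerDl sumr_ge0 // => F _.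
by case: ifP => // _; rewrite invr_ge0 ltW.
Qed.

Let I : finType := option (subgraph G).
Let co (v : 'rV[R]_#|I|) (i : I) : R := v 0 (enum_rank i).

Let co_cont (i : I) : continuous (co^~ i).
Proof. exact: coord_continuous. Qed.

Let cosum_cont (P : pred (subgraph G)) :
  continuous (fun v => \sum_(F | P F) co v (Some F)).
Proof.
elim: (index_enum _) => [|F s IHs] /= v.
  under eq_fun do rewrite big_nil; exact: cst_continuous.
under eq_fun do rewrite big_cons.
case: (P F); last exact: IHs.
exact: cvgD (@co_cont (Some F) v) (IHs v).
Qed.

Let D : set 'rV[R]_#|I| := [set v |
  [/\ forall i, 0 <= co v i <= 1,
      linear_forest_dist (fun F => co v (Some F)) &
      forall e, e \in edges G ->
        co v None <= edge_prob (fun F => co v (Some F)) e]].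

Let closed_le_cont (T : topologicalType) (f g : T -> R) :
  continuous f -> continuous g -> closed [set x | f x <= g x].
Proof.
move=> cf cg.
rewrite (_ : [set x | _] = (fun x => g x - f x) @^-1` [set y | 0 <= y]).
  apply: preimage_closed; last exact: closed_ge.
  by move=> x _; apply: cvgB; [exact: cg | exact: cf].
by apply/seteqP; split => x /=; rewrite subr_ge0.
Qed.

Let closed_eq_cont (T : topologicalType) (f : T -> R) (a : R) :
  continuous f -> closed [set x | f x = a].
Proof.
move=> cf; apply: (@preimage_closed _ _ f [set y | y = a]).
  by move=> x _; exact: cf.
exact: closed_eq.
Qed.

Let closed_all (T : topologicalType) (J : Type) (P : J -> T -> Prop) :
  (forall j, closed [set x | P j x]) -> closed [set x | forall j, P j x].
Proof.
move=> cP.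
rewrite (_ : [set x | _] = \bigcap_j [set x | P j x]).
  by apply: closed_bigI => j _; exact: cP.
by apply/seteqP; split => x /= H j => [_|]; exact: H.
Qed.

Let compactD : compact D.
Proof.
apply: (@subclosed_compact _ _
  [set v : 'rV[R]_#|I| | forall i, `[0, 1]%classic (v 0 i)]); first last.
- move=> v [v01 _ _] i; have := v01 (enum_val i).
  by rewrite /co enum_valK /= in_itv.
- by apply: (@rV_compact R _ (fun=> `[0, 1]%classic)) => _; exact: segment_compact.
have -> : D = [set v | forall i, 0 <= co v i] `&` [set v | forall i, co v i <= 1]
  `&` [set v | \sum_F co v (Some F) = 1]
  `&` [set v | forall F, co v (Some F) != 0 -> linear_forest F]
  `&` [set v | forall e, e \in edges G ->
        co v None <= edge_prob (fun F => co v (Some F)) e].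
  apply/seteqP; split=> v /=.
    case=> v01 [_ v1 vL] vE; split=> //; split=> //; split=> //.
    by split=> i; have /andP[] := v01 i.
  case=> -[[[v0 v1] s1] vL] vE; by split=> // i; rewrite v0 v1.
do ! apply: closedI.
- apply: closed_all => i; apply: closed_le_cont; last exact: co_cont.
  exact: cst_continuous.
- apply: closed_all => i; apply: closed_le_cont; first exact: co_cont.
  exact: cst_continuous.
- exact/closed_eq_cont/cosum_cont.
- apply: closed_all => F; have [LF|nLF] := pselect (linear_forest F).
    suff -> : [set v | co v (Some F) != 0 -> linear_forest F] = setT.
      exact: closedT.
    by apply/seteqP; split=> v /=.
  suff -> : [set v | co v (Some F) != 0 -> linear_forest F] =
            [set v | co v (Some F) = 0].
    exact/closed_eq_cont/co_cont.
  apply/seteqP; split=> v /= => [H|->]; last by rewrite eqxx.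
  by apply/eqP/negP => /negP/H.
- apply: closed_all => e; apply: closed_all => _.
  by apply: closed_le_cont; [exact: co_cont | exact: cosum_cont].
Qed.

Let edge_prob_le1 (mu : subgraph G -> R) e :
  linear_forest_dist mu -> edge_prob mu e <= 1.
Proof.
case=> mu0 mu1 _; rewrite -mu1 /edge_prob.
by rewrite [leRHS](bigID (fun F : subgraph G => e \in F.2)) /= lerDl sumr_ge0.
Qed.

Let admissible_D k : edges G != finset.set0 -> fla_admissible R G k ->
  exists2 v, D v & co v None = k^-1.
Proof.
move=> /set0Pn[e eE] [k0 [mu [dmu emu]]].
pose v : 'rV[R]_#|I| :=
  \row_i (if enum_val i is Some F then mu F else k^-1).
have vS F : co v (Some F) = mu F by rewrite /co mxE enum_rankK.
have vN : co v None = k^-1 by rewrite /co mxE enum_rankK.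
have vE : (fun F => co v (Some F)) = mu by apply/funext.
exists v => //; split; rewrite ?vE ?vN //.
case=> [F|]; rewrite ?vS ?vN; last first.
  by rewrite invr_ge0 ltW //= (le_trans (emu e eE)) // edge_prob_le1.
case: dmu => mu0 mu1 _; rewrite mu0 /= -mu1 (bigD1 F) //= lerDl.
by rewrite sumr_ge0.
Qed.

Theorem fla_min : edges G != finset.set0 ->
  fla_admissible R G (fla R G) /\
  forall k, fla_admissible R G k -> fla R G <= k.
Proof.
move=> E0; have [k0 Ak0] := fla_admissible_neq0 E0.
have [v0 Dv0 v0k0] := admissible_D E0 Ak0.
have [v /set_mem Dv vmax] : exists2 v, v \in D &
    forall w, w \in D -> co w None <= co v None.
  apply: compact_EVT_max; [by exists v0 | exact: compactD |].
  by apply: continuous_subspaceT => w; exact: co_cont.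
have t0 : 0 < co v None.
  apply: lt_le_trans (vmax v0 (mem_set Dv0)).
  by rewrite v0k0 invr_gt0; case: Ak0.
have Av : fla_admissible R G (co v None)^-1.
  split; first by rewrite invr_gt0.
  case: Dv => _ dv ev; exists (fun F => co v (Some F)); split=> // e eE.
  by rewrite invrK ev.
have lbv k : fla_admissible R G k -> (co v None)^-1 <= k.
  move=> Ak; have [w Dw wk] := admissible_D E0 Ak.
  have k_gt0 : 0 < k by case: Ak.
  by rewrite -[k]invrK lef_pV2 ?posrE ?invr_gt0 // -wk vmax // inE.
suff -> : fla R G = (co v None)^-1 by [].
apply/eqP; rewrite eq_le; apply/andP; split.
  by apply: ge_inf => //; exists (co v None)^-1.
by apply: lb_le_inf => //; exists k0.
Qed.

End Attained.

(* Main.v *)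
Require Import Defs.
From mathcomp Require Import all_boot all_order all_algebra.
From mathcomp Require Import all_classical all_reals all_analysis.
From mathcomp Require Import ring lra zify.
Import Order.TTheory GRing.Theory Num.Theory.
Import numFieldNormedType.Exports.
Local Open Scope ring_scope.

Set Implicit Arguments.
Unset Strict Implicit.
Unset Printing Implicit Defensive.

(** Let [D] be the maximum degree of [G] and [k = D + s], where [s] is a large
    multiple of [log D].  The proof uses partial injections [f] of the vertex
    set into itself such that [f u = Some v] only if [u] and [v] are adjacent,
    that is, matchings of the bipartite double cover of [G].  The arcs
    [u -> f u] form disjoint directed paths and directed cycles, so [f] becomes
    a linear forest once an arc is removed from every cycle.  If [f] is random
    and contains each arc with probability exactly [1/k], then an edge, having
    two arcs, is covered with probability [2/k] minus a loss, and the theorem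
    follows if the loss is [O(log D / k^2)].

    The distribution is a hard-core one: [f] has probability proportional to
    the product of the activities [lam u (f u)].  Activities for which every
    arc has probability [1/k] exist ([uniform_activities]): they maximise the
    product of all activities divided by the [k]-th power of the partition
    function over a large box, and the correlation inequalities exclude a
    maximum on the boundary of the box.

    The correlation inequalities ([Zdel_correlation]) say that, when [u] is
    called unmatched if [f u = None] and free if it is not in the image of [f],
    the events that [u] is unmatched and that [v] is free are positively
    correlated, and the events that two different vertices are free are
    negatively correlated.  Let [del u >= s/k] be the probability that [u] is
    unmatched, which is also the probability that it is free.  The first
    inequality gives [lam u v <= 1 / (k * del u * del v)] ([activity_le]).  The
    second one gives a Chernoff bound: if [del u < 1/2], the probability that
    [u] is unmatched and that the total activity of the arcs from [u] to free
    vertices is below a quarter of its mean, which is of order [1 / del u], is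
    at most [exp (- s/8)] ([free_activity_tail]).

    Choosing the removed arc of a cycle uniformly, the loss at the arc
    [u -> v] is the sum over [l] of [1/l] times the probability that [u -> v]
    lies on a cycle of length [l].  Each of these probabilities is at most
    [257/k^2] ([cycle_bound]), so the cycles of length at most [k] contribute a
    harmonic sum, of order [log k / k^2], and the longer ones at most [1/k^2].
    To bound such a probability, remove [u -> v]: what remains is a path from
    the free vertex [v] to the unmatched vertex [u].  As the activity available
    to [u] is large, an event which ignores the arc leaving [u] is at least of
    order [1 / del u] times as likely as its intersection with the event that
    [u] is unmatched, up to a negligible error ([stop_bound]).  This gains a
    factor [del u].  The same argument at the predecessor [x] of [u] on the
    path ([reach_bound]) gains [del x], and with the negative correlation of the
    events that [u] and [v] are free and with [activity_le] for both removed
    arcs the product of all factors is of order [1/k^2]. *)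

(** * Partial injections and their weights *)

Section PartialInjections.
Variables (V : finType) (R : realType).
Implicit Types (f : {ffun V -> option V}) (u v y x : V) (lam : V -> V -> R).
Implicit Types (Phi Psi : {ffun V -> option V} -> R) (S T : {set V}).

(** A partial map is a partial injection if no two vertices have the same
    image. *)
Definition pinj f : bool :=
  [forall u, forall v, (f u != None) ==> (f u == f v) ==> (u == v)].

Lemma pinjP f :
  reflect (forall u v y, f u = Some y -> f v = Some y -> u = v) (pinj f).
Proof.
apply: (iffP forallP) => [H u v y fu fv|H u].
  by have /forallP/(_ v) := H u; rewrite fu fv eqxx /= => /eqP.
apply/forallP => v; apply/implyP; case fu: (f u) => [y|//] _.
by apply/implyP => /eqP fv; apply/eqP/(H _ _ y).
Qed.

(** [free f y]: the vertex [y] is not an image of [f]. *)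
Definition free f y : bool := [forall u, f u != Some y].

Lemma freeP f y : reflect (forall u, f u <> Some y) (free f y).
Proof. by apply: (iffP forallP) => H u; apply/eqP/(H u). Qed.

(** [upd f u o] gives [u] the image [o], and removes the arc leaving [u] when
    [o] is [None]. *)
Definition upd f u (o : option V) : {ffun V -> option V} :=
  [ffun x => if x == u then o else f x].

Lemma updE f u o x : upd f u o x = if x == u then o else f x.
Proof. by rewrite ffunE. Qed.

Lemma upd_id f u o : f u = o -> upd f u o = f.
Proof. by move=> <-; apply/ffunP => x; rewrite updE; case: eqP => [->|]. Qed.

Lemma upd_upd f u o o' : upd (upd f u o) u o' = upd f u o'.
Proof. by apply/ffunP => x; rewrite !updE; case: eqP. Qed.

Lemma pinj_upd_None f u : pinj f -> pinj (upd f u None).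
Proof.
move=> /pinjP fi; apply/pinjP => a b y; rewrite !updE.
by case: (a == u) => //; case: (b == u) => //; exact: fi.
Qed.

Lemma pinj_upd_Some f u v : pinj f -> free f v -> pinj (upd f u (Some v)).
Proof.
move=> /pinjP fi /freeP fv; apply/pinjP => a b y; rewrite !updE.
case: (eqVneq a u) => [->|_]; case: (eqVneq b u) => [-> //|_].
- by move=> [<-] /fv.
- by move=> H [E]; move: H; rewrite -E => /fv.
- exact: fi.
Qed.

Lemma free_upd_None f u v : pinj f -> f u = Some v -> free (upd f u None) v.
Proof.
move=> /pinjP fi fu; apply/freeP => a; rewrite updE.
by case: eqVneq => // /eqP au /fi/(_ fu).
Qed.

Lemma free_upd_Some f u v y : y != v -> free f y -> free (upd f u (Some v)) y.
Proof.
move=> yv /freeP fy; apply/freeP => a; rewrite updE; case: eqP => // _ [E].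
by rewrite E eqxx in yv.
Qed.

Lemma free_upd_Some_inv f u v y :
  f u = None -> free (upd f u (Some v)) y -> free f y.
Proof.
move=> fu /freeP fy; apply/freeP => a; move: (fy a); rewrite updE.
by case: eqP => // ->; rewrite fu.
Qed.

Lemma free_upd_Some_neq f u v y : free (upd f u (Some v)) y -> y != v.
Proof.
move=> /freeP/(_ u); rewrite updE eqxx => H; apply/eqP => E.
by apply: H; rewrite E.
Qed.

(** The product of the activities of the arcs of [f]. *)
Definition weight lam f : R := \prod_u (if f u is Some v then lam u v else 1).

Lemma weight_upd lam f u v : f u = None ->
  weight lam (upd f u (Some v)) = lam u v * weight lam f.
Proof.
move=> fu; rewrite /weight (bigD1 u) //= updE eqxx; congr (_ * _).
rewrite [RHS](bigD1 u) //= fu mul1r.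
by apply: eq_bigr => a /negPf au; rewrite updE au.
Qed.

(** The unnormalised hard-core expectation of [Phi], so that [Esum lam (fun=>
    1)] is the partition function. *)
Definition Esum lam Phi : R := \sum_(f | pinj f) weight lam f * Phi f.

Lemma eq_Esum lam Phi Psi : (forall f, pinj f -> Phi f = Psi f) ->
  Esum lam Phi = Esum lam Psi.
Proof. by move=> H; apply: eq_bigr => f pf; rewrite H. Qed.

Lemma EsumD lam Phi Psi :
  Esum lam (fun f => Phi f + Psi f) = Esum lam Phi + Esum lam Psi.
Proof. by rewrite /Esum -big_split; apply: eq_bigr => f _; rewrite mulrDr. Qed.

Lemma EsumZ lam c Phi : Esum lam (fun f => c * Phi f) = c * Esum lam Phi.
Proof. by rewrite /Esum mulr_sumr; apply: eq_bigr => f _; rewrite mulrCA. Qed.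

Lemma Esum_sum lam (I : finType) (P : pred I)
    (F : I -> {ffun V -> option V} -> R) :
  Esum lam (fun f => \sum_(i | P i) F i f) = \sum_(i | P i) Esum lam (F i).
Proof.
rewrite /Esum exchange_big /=; apply: eq_bigr => f _; exact: mulr_sumr.
Qed.

(** Partial injections containing the arc [u -> v] correspond to those with [u]
    unmatched and [v] free.  All recursions and switchings below come from this
    bijection. *)
Lemma Esum_insert lam Phi u v :
  Esum lam (fun f => (f u == Some v)%:R * Phi f) =
  lam u v * Esum lam (fun f => ((f u == None) && free f v)%:R *
                               Phi (upd f u (Some v))).
Proof.
pose w := weight lam.
transitivity (\sum_(f | pinj f && (f u == Some v)) w f * Phi f).
  rewrite big_mkcondr; apply: eq_bigr => f _.
  by case: ifP => _; rewrite ?mul1r // mul0r mulr0.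
transitivity (lam u v * \sum_(f | pinj f && ((f u == None) && free f v))
                w f * Phi (upd f u (Some v))); last first.
  rewrite big_mkcondr; congr (_ * _); apply: eq_bigr => f _.
  by case: ifP => _; rewrite ?mul1r // mul0r mulr0.
rewrite mulr_sumr.
rewrite (reindex_onto (fun f => upd f u (Some v)) (fun f => upd f u None)) /=.
  have iffE f : pinj (upd f u (Some v)) && (upd f u (Some v) u == Some v) &&
      (upd (upd f u (Some v)) u None == f) =
      pinj f && ((f u == None) && free f v).
    rewrite upd_upd updE !eqxx andbT; apply/andP/and3P => [[pf /eqP fK]|].
      have fN : f = upd (upd f u (Some v)) u None by rewrite upd_upd.
      split; first by rewrite fN pinj_upd_None.
        by rewrite -fK updE eqxx.
      by rewrite fN free_upd_None // updE eqxx.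
    by case=> pf /eqP fu fv; rewrite pinj_upd_Some // upd_id.
  apply: eq_big => [f|f]; rewrite iffE // => /and3P[_ /eqP fu _].
  by rewrite /w weight_upd // mulrA.
by move=> f /andP[_ /eqP fu]; rewrite upd_upd upd_id.
Qed.

Lemma Esum_split_out lam Phi u :
  Esum lam Phi = Esum lam (fun f => (f u == None)%:R * Phi f) +
    \sum_v Esum lam (fun f => (f u == Some v)%:R * Phi f).
Proof.
rewrite -Esum_sum -EsumD; apply: eq_Esum => f _.
rewrite -mulr_suml -mulrDl; case fu: (f u) => [v|] /=.
  rewrite add0r (bigD1 v) //= eqxx big1 ?addr0 ?mul1r // => y /negPf yv.
  by rewrite (inj_eq (@Some_inj _)) eq_sym yv.
by rewrite big1 ?addr0 ?mul1r.
Qed.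

Lemma Esum_split_in lam Phi v :
  Esum lam Phi = Esum lam (fun f => (free f v)%:R * Phi f) +
    \sum_u Esum lam (fun f => (f u == Some v)%:R * Phi f).
Proof.
rewrite -Esum_sum -EsumD; apply: eq_Esum => f /pinjP pf.
rewrite -mulr_suml -mulrDl; case: (boolP (free f v)) => [/freeP fv|].
  by rewrite big1 ?addr0 ?mul1r // => u _; case: eqP => // /fv.
rewrite /free negb_forall => /existsP[u /negbNE/eqP fu].
rewrite add0r (bigD1 u) //= fu eqxx big1 ?addr0 ?mul1r // => a au.
by case: eqP => // /pf/(_ fu) E; rewrite E eqxx in au.
Qed.

(** * Correlation inequalities *)

(** No arc of [f] leaves [S] or enters [T]. *)
Definition avoids S T f : bool :=
  [forall u in S, f u == None] && [forall y in T, free f y].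

(** The partition function after deletion of the tails in [S] and of the heads
    in [T]. *)
Definition Zdel lam S T : R := Esum lam (fun f => (avoids S T f)%:R).

Lemma avoidsU1l u S T f : avoids (u |: S) T f = (f u == None) && avoids S T f.
Proof.
rewrite /avoids andbA; congr (_ && _).
apply/forallP/andP => [H|[fu /forallP H] x].
  split; first by have := H u; rewrite !inE eqxx.
  apply/forallP => x; apply/implyP => xS.
  by have /implyP := H x; apply; rewrite !inE xS orbT.
by rewrite !inE; apply/implyP => /orP[/eqP ->//|]; have /implyP := H x.
Qed.

Lemma avoidsU1r y S T f : avoids S (y |: T) f = free f y && avoids S T f.
Proof.
rewrite /avoids andbCA; congr (_ && _).
apply/forallP/andP => [H|[fu /forallP H] x].
  split; first by have := H y; rewrite !inE eqxx.
  apply/forallP => x; apply/implyP => xS.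
  by have /implyP := H x; apply; rewrite !inE xS orbT.
by rewrite !inE; apply/implyP => /orP[/eqP ->//|]; have /implyP := H x.
Qed.

Lemma avoids0 f : avoids finset.set0 finset.set0 f.
Proof.
by rewrite /avoids; apply/andP; split; apply/forallP => x; rewrite !inE.
Qed.

Lemma avoids_upd u v S T f : f u = None -> free f v ->
  avoids S T (upd f u (Some v)) = [&& u \notin S, v \notin T & avoids S T f].
Proof.
move=> fu fv; apply/andP/and3P => [[/forallP HS /forallP HT]|].
  split.
  - by apply/negP => uS; have /implyP/(_ uS) := HS u; rewrite updE eqxx.
  - apply/negP => vT; have /implyP/(_ vT)/free_upd_Some_neq := HT v.
    by rewrite eqxx.
  - apply/andP; split; apply/forallP => x; apply/implyP => xA.
      by have /implyP/(_ xA) := HS x; rewrite updE; case: (x == u).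
    by have /implyP/(_ xA)/free_upd_Some_inv := HT x; apply.
case=> uS vT /andP[/forallP HS /forallP HT].
split; apply/forallP => x; apply/implyP => xA.
  rewrite updE; case: (eqVneq x u) => [E|_]; first by rewrite -E xA in uS.
  by have /implyP := HS x; apply.
apply: free_upd_Some; first by apply: contraNneq vT => <-.
by have /implyP := HT x; apply.
Qed.

Lemma Zdel_insert lam S T u v : u \notin S -> v \notin T ->
  Esum lam (fun f => (f u == Some v)%:R * (avoids S T f)%:R) =
  lam u v * Zdel lam (u |: S) (v |: T).
Proof.
move=> uS vT; rewrite Esum_insert; congr (_ * _); apply: eq_Esum => f _.
rewrite avoidsU1l avoidsU1r; case: eqP => [fu|] /=; last by rewrite mul0r.
case: (boolP (free f v)) => fv /=; last by rewrite mul0r.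
by rewrite mul1r avoids_upd // uS vT.
Qed.

Lemma Zdel_out lam S T u : u \notin S ->
  Zdel lam S T = Zdel lam (u |: S) T +
    \sum_(y | y \notin T) lam u y * Zdel lam (u |: S) (y |: T).
Proof.
move=> uS; rewrite {1}/Zdel (Esum_split_out lam _ u); congr (_ + _).
  by apply: eq_Esum => f _; rewrite avoidsU1l -mulnb natrM.
rewrite [RHS]big_mkcond; apply: eq_bigr => y _; case: ifPn => yT.
  exact: Zdel_insert.
apply: big1 => f _; case: eqP => [fu|_]; last by rewrite mul0r mulr0.
suff -> : avoids S T f = false by rewrite !mulr0.
apply/negP => /andP[_ /forallP/(_ y)/implyP/(_ (negbNE yT))/freeP].
by move/(_ u).
Qed.

Lemma Zdel_in lam S T y : y \notin T ->
  Zdel lam S T = Zdel lam S (y |: T) +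
    \sum_(u | u \notin S) lam u y * Zdel lam (u |: S) (y |: T).
Proof.
move=> yT; rewrite {1}/Zdel (Esum_split_in lam _ y); congr (_ + _).
  by apply: eq_Esum => f _; rewrite avoidsU1r -mulnb natrM.
rewrite [RHS]big_mkcond; apply: eq_bigr => u _; case: ifPn => uS.
  exact: Zdel_insert.
apply: big1 => f _; case: eqP => [fu|_]; last by rewrite mul0r mulr0.
suff -> : avoids S T f = false by rewrite !mulr0.
by apply/negP => /andP[/forallP/(_ u)/implyP/(_ (negbNE uS))]; rewrite fu.
Qed.

Section Nonneg.
Variable lam : V -> V -> R.
Hypothesis lam_ge0 : forall u v, 0 <= lam u v.

Lemma weight_ge0 f : 0 <= weight lam f.
Proof. by apply: prodr_ge0 => u _; case: (f u). Qed.

Lemma le_Esum Phi Psi : (forall f, pinj f -> Phi f <= Psi f) ->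
  Esum lam Phi <= Esum lam Psi.
Proof.
by move=> H; apply: ler_sum => f pf; rewrite ler_wpM2l ?weight_ge0 ?H.
Qed.

Lemma Esum_ge0 Phi : (forall f, pinj f -> 0 <= Phi f) -> 0 <= Esum lam Phi.
Proof.
by move=> H; apply: sumr_ge0 => f pf; rewrite mulr_ge0 ?weight_ge0 ?H.
Qed.

Lemma Zdel_ge0 S T : 0 <= Zdel lam S T.
Proof. exact: Esum_ge0. Qed.

(** Unmatched tails and free heads are positively correlated, two free heads
    are negatively correlated.  Expansion along the arcs leaving [u] reduces
    the first inequality to the second one with [u] deleted, and expansion
    along the arcs entering [y] reduces the second one to the first one with
    [y] deleted. *)
Lemma Zdel_correlation S T :
  (forall u v, u \notin S -> v \notin T ->
    Zdel lam (u |: S) T * Zdel lam S (v |: T) <=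
    Zdel lam S T * Zdel lam (u |: S) (v |: T)) /\
  (forall v y, v \notin T -> y \notin T -> v != y ->
    Zdel lam S T * Zdel lam S (v |: (y |: T)) <=
    Zdel lam S (v |: T) * Zdel lam S (y |: T)).
Proof.
have [n leSn] := ubnP (#|~: S| + #|~: T|)%N.
elim: n => // n IHn in S T leSn *.
have dS (A : {set V}) x : x \notin A -> #|~: A| = (#|~: (x |: A)|).+1.
  move=> xA; rewrite (cardsD1 x (~: A)) inE xA add1n; congr _.+1.
  by apply: eq_card => z; rewrite !inE negb_or.
split=> [u v uS vT|v y vT yT vy].
  rewrite (Zdel_out lam T uS) (Zdel_out lam (v |: T) uS) mulrDl mulrDr.
  rewrite lerD2l mulr_sumr mulr_suml.
  rewrite [leRHS](bigID (fun y => y != v)) /= -[leLHS]addr0 lerD //.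
    rewrite [leLHS]big_mkcond [leRHS]big_mkcond /=; apply: ler_sum => y _.
    rewrite !inE negb_or andbC; case: ifP => // /andP[yT yv].
    rewrite mulrCA -[leRHS]mulrA ler_wpM2l //.
    have [_] := IHn (u |: S) T ltac:(move: leSn; rewrite (dS _ _ uS); lia).
    exact.
  by apply: sumr_ge0 => y _; rewrite !mulr_ge0 ?Zdel_ge0.
have yvT : y \notin v |: T by rewrite !inE negb_or yT eq_sym vy.
rewrite (Zdel_in lam S yT) (Zdel_in lam S yvT).
rewrite (finset.setUCA [set y] [set v] T) !mulrDl.
rewrite [Zdel lam S (v |: (y |: T)) * _]mulrC lerD2l !mulr_suml.
apply: ler_sum => u uS; rewrite -!mulrA ler_wpM2l //.
have [+ _] := IHn S (y |: T) ltac:(move: leSn; rewrite (dS _ _ yT); lia).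
move/(_ u v uS); rewrite !inE negb_or vy vT => /(_ isT).
by rewrite [X in _ <= X -> _]mulrC.
Qed.

End Nonneg.
End PartialInjections.

(** * Negative association of free vertices *)

Section NegativeAssociation.
Variables (V : finType) (R : realType).
Implicit Types (f : {ffun V -> option V}) (u v y x : V) (lam : V -> V -> R).
Implicit Types (Phi Psi : {ffun V -> option V} -> R) (S T : {set V}).

Lemma Zdel_gt0 lam S T : (forall u v, 0 <= lam u v) -> 0 < Zdel lam S T.
Proof.
move=> lam0; pose f0 : {ffun V -> option V} := [ffun=> None].
have f0i : pinj f0 by apply/pinjP => a b y; rewrite ffunE.
rewrite /Zdel /Esum (bigD1 f0) //=.
have -> : avoids S T f0.
  apply/andP; split; apply/forallP => x; apply/implyP => _.
    by rewrite ffunE.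
  by apply/freeP => a; rewrite ffunE.
rewrite mulr1 /weight big1 => [|u _]; last by rewrite ffunE.
apply: ltr_pwDl => //; apply: sumr_ge0 => f _.
by rewrite mulr_ge0 ?weight_ge0.
Qed.

(** The activities of the arcs entering [y0] are multiplied by [t]. *)
Definition scale_col lam y0 (t : R) u y : R :=
  if y == y0 then lam u y * t else lam u y.

Lemma weight_scale_col lam y0 t f : pinj f ->
  weight (scale_col lam y0 t) f =
  weight lam f * (if free f y0 then 1 else t).
Proof.
move=> /pinjP fi; rewrite /weight; case: (boolP (free f y0)) => [/freeP fy|].
  rewrite mulr1; apply: eq_bigr => u _; have := fy u.
  case: (f u) => // v; rewrite /scale_col; case: eqP => // -> .
  by move=> /(_ erefl).
rewrite negb_forall => /existsP[u /negbNE/eqP fu].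
rewrite (bigD1 u) //= [in RHS](bigD1 u) //= fu /scale_col eqxx.
rewrite -!mulrA; congr (_ * _); rewrite mulrC; congr (_ * _).
apply: eq_bigr => a au; case fa: (f a) => [z|] //; case: eqP => // zy.
by move: fa; rewrite zy => /fi/(_ fu) E; rewrite E eqxx in au.
Qed.

(** A factor that penalises the event that [y0] is free amounts to a change of
    the activities of the arcs entering [y0]. *)
Lemma Esum_tilt lam y0 (c : R) Phi : c < 1 ->
  Esum lam (fun f => (1 - c * (free f y0)%:R) * Phi f) =
  (1 - c) * Esum (scale_col lam y0 (1 - c)^-1) Phi.
Proof.
move=> c1; rewrite /Esum mulr_sumr; apply: eq_bigr => f fi.
rewrite weight_scale_col //; case: (free f y0) => /=.
  by rewrite mulr1; ring.
by field; rewrite subr_eq0 gt_eqF.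
Qed.

Lemma Zdel_tilt lam y0 (c : R) S T : c < 1 ->
  Zdel lam S T - c * Zdel lam S (y0 |: T) =
  (1 - c) * Zdel (scale_col lam y0 (1 - c)^-1) S T.
Proof.
move=> c1; rewrite /Zdel -Esum_tilt // -mulNr -EsumZ -EsumD.
apply: eq_Esum => f _; rewrite avoidsU1r -mulnb natrM; ring.
Qed.

(** The indicators of the events that the vertices of [ys] are free satisfy the
    negative association inequality needed for a Chernoff bound: removing one
    factor at a time by [Esum_tilt], the changed activities only make the other
    vertices more likely to be free. *)
Lemma free_product_bound lam S (ys : seq V) (c : V -> R) :
  (forall u v, 0 <= lam u v) -> uniq ys ->
  (forall y, 0 <= c y < 1) ->
  Esum lam (fun f => (avoids S finset.set0 f)%:R *
    \prod_(y <- ys) (1 - c y * (free f y)%:R)) <=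
  Zdel lam S finset.set0 * \prod_(y <- ys)
    (1 - c y * (Zdel lam S [set y]%SET / Zdel lam S finset.set0)).
Proof.
move=> lam0 + c01; elim: ys lam lam0 => [|y0 ys IHys] lam lam0.
  move=> _; rewrite big_nil mulr1 /Zdel.
  rewrite le_eqVlt; apply/orP; left; apply/eqP/eq_Esum => f _.
  by rewrite big_nil mulr1.
move=> /= /andP[y0ys uys].
have /andP[c0 c1] := c01 y0.
have mu0 : 0 < 1 - c y0 by rewrite subr_gt0.
set lam' := scale_col lam y0 (1 - c y0)^-1.
have lam'0 u v : 0 <= lam' u v.
  rewrite /lam' /scale_col; case: ifP => // _.
  by rewrite mulr_ge0 // invr_ge0 ltW.
under eq_Esum => f _ do rewrite big_cons mulrCA.
rewrite Esum_tilt // -/lam' big_cons.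
have Zp := Zdel_gt0 S finset.set0 lam0.
have Zp' := Zdel_gt0 S finset.set0 lam'0.
have -> : Zdel lam S finset.set0 * ((1 - c y0 *
    (Zdel lam S [set y0]%SET / Zdel lam S finset.set0)) *
    \prod_(y <- ys) (1 - c y * (Zdel lam S [set y]%SET / Zdel lam S finset.set0)))
  = (1 - c y0) * (Zdel lam' S finset.set0 *
    \prod_(y <- ys) (1 - c y * (Zdel lam S [set y]%SET / Zdel lam S finset.set0))).
  rewrite !mulrA -Zdel_tilt // finset.setU0; congr (_ * _).
  by field; rewrite gt_eqF.
rewrite ler_pM2l //; apply: le_trans (IHys lam' lam'0 uys) _.
rewrite ler_pM2l //; rewrite !big_seq; apply: ler_prod => y yys.
have /andP[cy0 cy1] := c01 y.
have yy0 : y0 != y by apply: contraNneq y0ys => ->.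
have rle : Zdel lam S [set y]%SET / Zdel lam S finset.set0 <=
    Zdel lam' S [set y]%SET / Zdel lam' S finset.set0.
  have e1 := Zdel_tilt lam y0 S finset.set0 c1.
  have e2 := Zdel_tilt lam y0 S [set y]%SET c1.
  have [_] := Zdel_correlation lam0 S finset.set0.
  move=> /(_ y0 y); rewrite !inE !finset.setU0 => /(_ isT isT yy0) H.
  rewrite ler_pdivrMr // mulrAC ler_pdivlMr // -(ler_pM2l mu0).
  rewrite mulrCA -e1 [leRHS]mulrA -e2 finset.setU0 mulrBr mulrBl lerD2l lerN2.
  by rewrite mulrCA -mulrA ler_wpM2l // mulrC [leRHS]mulrC.
have r'1 : Zdel lam' S [set y]%SET <= Zdel lam' S finset.set0.
  apply: le_Esum => // f _; rewrite -(finset.setU0 [set y]%SET) avoidsU1r.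
  by rewrite -mulnb natrM ler_piMl // lern1 leq_b1.
apply/andP; split; last by rewrite lerB // ler_wpM2l.
rewrite subr_ge0 mulr_ile1 ?(ltW cy1) ?divr_ge0 ?Zdel_ge0 //.
by rewrite ler_pdivrMr // mul1r.
Qed.

End NegativeAssociation.

(** * Activities giving all arcs the same probability *)

Section Existence.
Variables (V : finType) (R : realType).
Implicit Types (f : {ffun V -> option V}) (u v y : V) (lam : V -> V -> R).

Lemma bernoulli_le (x : R) (k : nat) : -1 <= x ->
  1 + k%:R * x <= (1 + x) ^+ k.
Proof.
move=> x1; elim: k => [|k IHk]; first by rewrite mul0r addr0 expr0.
rewrite exprS; apply: le_trans (_ : (1 + x) * (1 + k%:R * x) <= _).
  have k0 : (0 : R) <= k%:R by [].
  rewrite -natr1; nra.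
by rewrite ler_wpM2l //; lra.
Qed.

(** The first-order condition at a maximum of [t / (Z + (t - 1) * A) ^ k] at [t
    = 1], for the increment [e] of [t]. *)
Lemma power_slope (Z A e : R) (k : nat) : 0 < Z -> 0 <= A <= Z -> `|e| <= 1 ->
  (1 + e) * Z ^+ k <= (Z + e * A) ^+ k ->
  e * (Z - k%:R * A) <= k%:R * A * e ^+ 2.
Proof.
move=> Z0 /andP[A0 AZ] e1 H; pose P := A / Z.
have AE : A = P * Z by rewrite /P divfK // gt_eqF.
have P0 : 0 <= P by rewrite divr_ge0 // ltW.
have P1 : P <= 1 by rewrite ler_pdivrMr // mul1r.
have eP : `|e * P| <= 1 by rewrite normrM (ger0_norm P0) mulr_ile1.
have {}H : 1 + e <= (1 + e * P) ^+ k.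
  rewrite -(@ler_pM2r _ (Z ^+ k)) ?exprn_gt0 // -exprMn.
  by apply: le_trans H _; rewrite AE mulrDl mul1r mulrA.
have B : 1 + k%:R * (- (e * P)) <= (1 - e * P) ^+ k.
  by apply: bernoulli_le; rewrite lerN2; move: eP; rewrite ler_norml => /andP[].
move: e1 eP; rewrite !ler_norml => /andP[e1 e1'] /andP[eP eP'].
have le1 : (1 + e) * (1 + k%:R * (- (e * P))) <= 1.
  have [neg|pos] := leP (1 + k%:R * (- (e * P))) 0.
    by apply: le_trans (_ : 0 <= _) => //; rewrite mulr_ge0_le0 //; lra.
  apply: le_trans (_ : (1 + e * P) ^+ k * (1 - e * P) ^+ k <= _).
    apply: ler_pM => //; first by lra.
    exact: ltW.
  rewrite -exprMn exprn_ile1 //; nra.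
rewrite AE.
suff : (e * (1 - k%:R * P)) * Z <= (k%:R * P * e ^+ 2) * Z by lra.
rewrite ler_pM2r //; lra.
Qed.

Lemma slope_ge (Z A e0 : R) (k : nat) : 0 < Z -> 0 <= A <= Z -> 0 < e0 ->
  (forall e, 0 < e -> e <= e0 -> (1 + e) * Z ^+ k <= (Z + e * A) ^+ k) ->
  Z <= k%:R * A.
Proof.
move=> Z0 AZ e00 H; rewrite leNgt; apply/negP => lt.
have kA0 : 0 <= k%:R * A by case/andP: AZ => A0 _; rewrite mulr_ge0.
pose d := Z - k%:R * A.
pose e := Num.min (Num.min e0 1) (d / (2 * (Z + 1))).
have d0 : 0 < d by rewrite subr_gt0.
have ep : 0 < e by rewrite !lt_min e00 ltr01 divr_gt0 //; lra.
have [ee0 e1] : e <= e0 /\ e <= 1.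
  by split; rewrite /e !ge_min lexx ?orbT.
have ed : e <= d / (2 * (Z + 1)) by rewrite /e ge_min lexx orbT.
have Zp : 0 < 2 * (Z + 1) by lra.
have {}ed : e * (2 * (Z + 1)) <= d by rewrite -ler_pdivlMr.
have := power_slope Z0 AZ _ (H e ep ee0).
rewrite (ger0_norm (ltW ep)) => /(_ e1).
rewrite expr2 mulrCA ler_pM2l // -/d => le.
have : k%:R * A * e <= Z * e by rewrite ler_pM2r // ltW.
nra.
Qed.

Lemma slope_le (Z A e0 : R) (k : nat) : 0 < Z -> 0 <= A <= Z -> 0 < e0 ->
  (forall e, 0 < e -> e <= e0 -> (1 - e) * Z ^+ k <= (Z - e * A) ^+ k) ->
  k%:R * A <= Z.
Proof.
move=> Z0 AZ e00 H; rewrite leNgt; apply/negP => lt.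
have kA0 : 0 <= k%:R * A by case/andP: AZ => A0 _; rewrite mulr_ge0.
pose d := k%:R * A - Z; pose B := k%:R * A.
pose e := Num.min (Num.min e0 1) (d / (2 * (B + 1))).
have d0 : 0 < d by rewrite subr_gt0.
have ep : 0 < e by rewrite !lt_min e00 ltr01 divr_gt0 // /B; lra.
have [ee0 e1] : e <= e0 /\ e <= 1.
  by split; rewrite /e !ge_min lexx ?orbT.
have ed : e <= d / (2 * (B + 1)) by rewrite /e ge_min lexx orbT.
have Zp : 0 < 2 * (B + 1) by rewrite /B; lra.
have {}ed : e * (2 * (B + 1)) <= d by rewrite -ler_pdivlMr.
have := @power_slope Z A (- e) k Z0 AZ.
rewrite normrN (ger0_norm (ltW ep)) mulNr => /(_ e1 (H e ep ee0)).
rewrite sqrrN expr2 mulrCA mulNr -mulrN opprB ler_pM2l // -/d -/B => le.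
nra.
Qed.

Lemma continuous_prod (T : topologicalType) (I : Type) (s : seq I) (P : pred I)
    (F : I -> T -> R) : (forall i, continuous (F i)) ->
  continuous (fun x => \prod_(i <- s | P i) F i x).
Proof.
move=> cF; elim: s => [|i s IHs] x.
  under eq_fun do rewrite big_nil; exact: cst_continuous.
under eq_fun do rewrite big_cons.
case: (P i); last exact: IHs.
by apply: cvgM; [exact: cF | exact: IHs].
Qed.

Lemma continuous_sum (T : topologicalType) (I : Type) (s : seq I) (P : pred I)
    (F : I -> T -> R) : (forall i, continuous (F i)) ->
  continuous (fun x => \sum_(i <- s | P i) F i x).
Proof.
move=> cF; elim: s => [|i s IHs] x.
  under eq_fun do rewrite big_nil; exact: cst_continuous.
under eq_fun do rewrite big_cons.
case: (P i); last exact: IHs.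
by apply: cvgD; [exact: cF | exact: IHs].
Qed.

(** The activity of the single arc [u0 -> y0] is multiplied by [t]. *)
Definition scale_entry lam u0 y0 (t : R) u y : R :=
  if (u == u0) && (y == y0) then t * lam u y else lam u y.

Lemma weight_scale_entry lam u0 y0 t f :
  weight (scale_entry lam u0 y0 t) f =
  weight lam f * (if f u0 == Some y0 then t else 1).
Proof.
rewrite /weight (bigD1 u0) //= [in RHS](bigD1 u0) //= -!mulrA.
have -> : \prod_(u | u != u0) (if f u is Some v then scale_entry lam u0 y0 t u v
    else 1) = \prod_(u | u != u0) (if f u is Some v then lam u v else 1).
  by apply: eq_bigr => u /negPf uu0; rewrite /scale_entry uu0.
case fu: (f u0) => [z|] //=; last by rewrite mulr1.
rewrite /scale_entry eqxx (inj_eq (@Some_inj _)) /=.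
case: eqP => _; last by rewrite mulr1.
ring.
Qed.

Variables (adj : rel V) (D k : nat).
Hypotheses (deg_out : forall u, (#|[set y | adj u y]%SET| <= D)%N).
Hypotheses (deg_in : forall y, (#|[set u | adj u y]%SET| <= D)%N).
Hypotheses (Dk : (D < k)%N).

Let I : finType := (V * V)%type.
Let co (x : 'rV[R]_#|I|) (u v : V) : R := x 0 (enum_rank (u, v)).
Let mlam (x : 'rV[R]_#|I|) (u v : V) : R := if adj u v then co x u v else 0.
Let Z (x : 'rV[R]_#|I|) : R := Esum (mlam x) (fun=> 1).
Let obj (x : 'rV[R]_#|I|) : R :=
  (\prod_(e : I | adj e.1 e.2) co x e.1 e.2) / Z x ^+ k.
Let k0 : 0 < k%:R :> R. Proof. by rewrite ltr0n; lia. Qed.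
Let lo : R := (2 * k%:R)^-1.
Let hi : R := 2 * k%:R.
Let lo0 : 0 < lo. Proof. by rewrite /lo invr_gt0 mulr_gt0. Qed.
Let lohi : lo < 1 < hi.
Proof.
have k1 : 1 <= k%:R :> R by rewrite ler1n; lia.
apply/andP; split; last by rewrite /hi; lra.
by rewrite /lo invf_lt1; lra.
Qed.
Let box : set 'rV[R]_#|I| :=
  [set x | forall i, `[lo, hi]%classic (x 0 i)]%classic.

Let co_cont u v : continuous (fun x => co x u v).
Proof. exact: coord_continuous. Qed.

Let weight_cont f : continuous (fun x => weight (mlam x) f).
Proof.
apply: (@continuous_prod _ _ _ _
  (fun u x => if f u is Some v then mlam x u v else 1)) => u.
case: (f u) => [v|]; last exact: cst_continuous.
rewrite /mlam; case: (adj u v); [exact: co_cont | exact: cst_continuous].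
Qed.

Let Z_cont : continuous Z.
Proof.
apply: (@continuous_sum _ _ _ _ (fun f x => weight (mlam x) f * 1)) => f x.
exact: cvgM (@weight_cont f x) (@cst_continuous _ _ (1 : R) x).
Qed.

Let mlam_ge0 x : box x -> forall u v, 0 <= mlam x u v.
Proof.
move=> bx u v; rewrite /mlam; case: ifP => // _.
have := bx (enum_rank (u, v)); rewrite /= in_itv /= => /andP[+ _].
by apply: le_trans; rewrite ltW.
Qed.

Let ZE x : Z x = Zdel (mlam x) finset.set0 finset.set0.
Proof. by apply: eq_Esum => f _; rewrite avoids0. Qed.

Let Z_gt0 x : box x -> 0 < Z x.
Proof. by move=> bx; rewrite ZE Zdel_gt0 //; exact: mlam_ge0. Qed.

Let max_obj : exists2 x, box x & forall x', box x' -> obj x' <= obj x.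
Proof.
have [x /set_mem bx xmax] : exists2 x, x \in box &
    forall x', x' \in box -> obj x' <= obj x.
  apply: compact_EVT_max.
  - exists (const_mx 1) => i /=; rewrite mxE in_itv /=.
    by case/andP: lohi => l h; rewrite !ltW.
  - apply: (@rV_compact R _ (fun=> `[lo, hi]%classic)) => _.
    exact: segment_compact.
  have cP : continuous (fun x => \prod_(e : I | adj e.1 e.2) co x e.1 e.2).
    apply: (@continuous_prod _ _ _ _ (fun e x => co x e.1 e.2)) => e.
    exact: co_cont.
  have cZ : continuous (fun x => Z x ^+ k).
    have -> : (fun x => Z x ^+ k) = (fun x => \prod_(i < k) Z x).
      by apply/funext => z; rewrite prodr_const card_ord.
    by apply: (@continuous_prod _ _ _ _ (fun _ => Z)) => _; exact: Z_cont.
  apply: continuous_in_subspaceT => x /set_mem bx.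
  have Zk0 : Z x ^+ k != 0 by rewrite gt_eqF // exprn_gt0 // Z_gt0.
  exact: cvgM (cP x) (cvgV Zk0 (cZ x)).
by exists x => // x' /mem_set; exact: xmax.
Qed.

(** If all degrees are at most [D < k], some activities give every arc
    probability [1/k]. *)
Lemma uniform_activities : exists lam : V -> V -> R,
  [/\ forall u v, 0 <= lam u v,
      forall u v, ~~ adj u v -> lam u v = 0 &
      forall u v, adj u v ->
        k%:R * Esum lam (fun f => (f u == Some v)%:R) = Esum lam (fun=> 1)].
Proof.
have [x bx xmax] := max_obj; pose lam := mlam x.
have lam0 := mlam_ge0 bx; have Z0 := Z_gt0 bx.
pose A u v := Esum lam (fun f => (f u == Some v)%:R).
have AZ u v : 0 <= A u v <= Z x.
  rewrite Esum_ge0 //=; apply: le_Esum => // f _; by rewrite lern1 leq_b1.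
have cob u v : lo <= co x u v <= hi.
  by have := bx (enum_rank (u, v)); rewrite /= in_itv.
(* Comparison of [x] with the point whose coordinate [(u, v)] is scaled by [t]. *)
have scaled u v t : adj u v -> 0 < t -> lo <= t * co x u v <= hi ->
    t * Z x ^+ k <= (Z x + (t - 1) * A u v) ^+ k.
  move=> uv t0 tb.
  pose x' : 'rV[R]_#|I| :=
    \row_i (if i == enum_rank (u, v) then t * x 0 i else x 0 i).
  have co' a b : co x' a b = if (a, b) == (u, v) then t * co x a b else co x a b.
    by rewrite /co mxE (inj_eq enum_rank_inj).
  have bx' : box x'.
    move=> i; rewrite /= in_itv /= mxE; case: eqP => [->//|_].
    by have := bx i; rewrite /= in_itv.
  have ml' : mlam x' = scale_entry lam u v t.
    apply/funext => a; apply/funext => b; rewrite /mlam /scale_entry /lam /mlam co'.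
    by rewrite xpair_eqE; case: ifP => // _; case: ifP => //; rewrite mulr0.
  have Z' : Z x' = Z x + (t - 1) * A u v.
    rewrite /Z ml' -EsumZ -EsumD; apply: eq_bigr => f _.
    by rewrite weight_scale_entry; case: eqP => _ /=; rewrite -/lam; ring.
  have := xmax x' bx'; rewrite /obj Z'.
  pose e0 : I := (u, v).
  rewrite (bigD1 e0) //= co' eqxx.
  have -> : \prod_(e : I | adj e.1 e.2 && (e != e0)) co x' e.1 e.2 =
      \prod_(e : I | adj e.1 e.2 && (e != e0)) co x e.1 e.2.
    apply: eq_bigr => -[a b] /andP[_ /negPf /=]; rewrite co' => ne.
    by rewrite ne.
  rewrite [X in _ <= X / _ -> _](bigD1 e0) //= -[t * _ * _]mulrA.
  set p := co x u v * _.
  have p0 : 0 < p.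
    have coP a b : 0 < co x a b.
      by case/andP: (cob a b) => l _; apply: lt_le_trans l.
    by rewrite mulr_gt0 // prodr_gt0.
  have Zx'0 : 0 < Z x + (t - 1) * A u v by rewrite -Z'; exact: Z_gt0.
  rewrite ler_pdivrMr ?exprn_gt0 // mulrAC ler_pdivlMr ?exprn_gt0 //.
  by rewrite [t * p]mulrC -[p * t * _]mulrA ler_pM2l.
have coP u v : 0 < co x u v.
  by case/andP: (cob u v) => l _; apply: lt_le_trans l.
(* The derivative in the direction of [u -> v] is nonpositive where the activity
   can increase, and nonnegative where it can decrease. *)
have grow u v : adj u v -> co x u v < hi -> Z x <= k%:R * A u v.
  move=> uv lth; have cp := coP u v.
  apply: (@slope_ge _ _ ((hi - co x u v) / co x u v) _ Z0 (AZ u v)).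
    by rewrite divr_gt0 // subr_gt0.
  move=> e e_gt0; rewrite ler_pdivlMr // => ele.
  have := @scaled u v (1 + e) uv; rewrite addrAC subrr add0r; apply; first lra.
  have /andP[cl _] := cob u v; rewrite mulrDl mul1r; apply/andP; split; last lra.
  by apply: le_trans cl _; rewrite lerDl mulr_ge0 // ltW.
have shrink u v : adj u v -> lo < co x u v -> k%:R * A u v <= Z x.
  move=> uv lth; have cp := coP u v.
  apply: (@slope_le _ _ ((co x u v - lo) / co x u v) _ Z0 (AZ u v)).
    by rewrite divr_gt0 // subr_gt0.
  move=> e e_gt0; rewrite ler_pdivlMr // => ele.
  have := @scaled u v (1 - e) uv; rewrite addrAC subrr add0r mulNr; apply.
    by rewrite -(pmulr_lgt0 _ cp) mulrBl mul1r; have := lo0; lra.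
  have /andP[_ ch] := cob u v; rewrite mulrBl mul1r; apply/andP; split; first lra.
  by apply: le_trans ch; rewrite lerBlDr lerDl mulr_ge0 // ltW.
have AE u v : A u v = lam u v * Zdel lam [set u]%SET [set v]%SET.
  have := @Zdel_insert V R lam finset.set0 finset.set0 u v.
  rewrite !inE !finset.setU0 => <- //; apply: eq_Esum => f _.
  by rewrite avoids0 mulr1.
have lamE u v : adj u v -> lam u v = co x u v by rewrite /lam /mlam => ->.
have ZdZ S T : Zdel lam S T <= Z x.
  by apply: le_Esum => // f _; rewrite lern1 leq_b1.
(* An arc has probability at most its activity, and [lo] is less than [1/k]. *)
have lo_lt u v : adj u v -> lo < co x u v.
  move=> uv; have /andP[+ _] := cob u v; rewrite le_eqVlt => /orP[/eqP loE|//].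
  have := grow u v uv; rewrite -loE => /(_ ltac:(case/andP: lohi; lra)).
  rewrite AE lamE // -loE => H.
  have : k%:R * (lo * Zdel lam [set u]%SET [set v]%SET) <= 2^-1 * Z x.
    rewrite mulrA [k%:R * lo](_ : _ = 2^-1) ?ler_wpM2l ?ZdZ //.
    by rewrite /lo; field; rewrite gt_eqF.
  by move: H Z0; lra.
have A_le u v : k%:R * A u v <= Z x.
  have [uv|nuv] := boolP (adj u v); first exact: shrink (lo_lt _ _ uv).
  by rewrite AE /lam /mlam (negPf nuv) mul0r mulr0 ltW.
have sum_le (s : {set V}) (F : V -> R) : (#|s| <= D)%N ->
    (forall v, v \in s -> k%:R * F v <= Z x) ->
    k%:R * (\sum_(v in s) F v) <= D%:R * Z x.
  move=> sD FZ; rewrite mulr_sumr.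
  apply: le_trans (_ : \sum_(v in s) Z x <= _); first exact: ler_sum.
  by rewrite sumr_const -[leLHS]mulr_natl ler_wpM2r ?ler_nat // ltW.
(* As no arc is more likely than [1/k], a vertex is unmatched, and free, with
   probability at least [1 - D/k >= 1/k]. *)
have freeL u : Z x <= k%:R * Zdel lam [set u]%SET finset.set0.
  have := @Zdel_out V R lam finset.set0 finset.set0 u.
  rewrite inE -ZE !finset.setU0 => /(_ isT) E.
  have := sum_le [set y | adj u y]%SET (A u) (deg_out u) (fun v _ => A_le u v).
  have <- : \sum_(y | y \notin finset.set0) lam u y *
      Zdel lam [set u]%SET (y |: finset.set0) =
      \sum_(v in [set y | adj u y]%SET) A u v.
    rewrite [RHS]big_mkcond /=; apply: eq_big => y; rewrite ?inE // => _.
    rewrite finset.setU0 -AE; case: ifPn => // nuy.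
    by rewrite AE /lam /mlam (negPf nuy) mul0r.
  have : D.+1%:R * Z x <= k%:R * Z x by rewrite ler_wpM2r ?ler_nat // ltW.
  rewrite -natr1; move: E; set S := \sum_(_ | _) _ => ->; lra.
have freeR v : Z x <= k%:R * Zdel lam finset.set0 [set v]%SET.
  have := @Zdel_in V R lam finset.set0 finset.set0 v.
  rewrite inE -ZE !finset.setU0 => /(_ isT) E.
  have := sum_le [set u | adj u v]%SET (A^~ v) (deg_in v) (fun u _ => A_le u v).
  have <- : \sum_(u | u \notin finset.set0) lam u v *
      Zdel lam (u |: finset.set0) [set v]%SET =
      \sum_(u in [set u | adj u v]%SET) A u v.
    rewrite [RHS]big_mkcond /=; apply: eq_big => y; rewrite ?inE // => _.
    rewrite finset.setU0 -AE; case: ifPn => // nuy.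
    by rewrite AE /lam /mlam (negPf nuy) mul0r.
  have : D.+1%:R * Z x <= k%:R * Z x by rewrite ler_wpM2r ?ler_nat // ltW.
  rewrite -natr1; move: E; set S := \sum_(_ | _) _ => ->; lra.
(* By positive correlation an arc of activity [hi] would be too likely. *)
have lt_hi u v : adj u v -> co x u v < hi.
  move=> uv; have /andP[_] := cob u v; rewrite le_eqVlt => /orP[/eqP hiE|//].
  have := A_le u v; rewrite AE lamE // hiE => H.
  have [+ _] := Zdel_correlation lam0 finset.set0 finset.set0.
  move=> /(_ u v); rewrite !inE !finset.setU0 -ZE => /(_ isT isT) C.
  have := freeL u; have := freeR v; have := Zdel_ge0 lam0 [set u]%SET [set v]%SET.
  move: C H; set a := Zdel _ _ _; set b := Zdel _ _ _; set c := Zdel _ _ _.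
  rewrite /hi => C H c0 Hb Ha.
  have : Z x * Z x <= (k%:R * a) * (k%:R * b) by apply: ler_pM => //; exact: ltW.
  have : k%:R * k%:R * (a * b) <= k%:R * k%:R * (Z x * c).
    by rewrite ler_wpM2l // mulr_ge0.
  have : Z x * (k%:R * (2 * k%:R * c)) <= Z x * Z x by rewrite ler_wpM2l // ltW.
  have : 0 < Z x * Z x by rewrite mulr_gt0.
  lra.
exists lam; split=> // [u v nuv|u v uv]; first by rewrite /lam /mlam (negPf nuv).
by apply/eqP; rewrite eq_le -/(A u v) A_le grow // lt_hi.
Qed.
End Existence.

(** * Trajectories of a partial injection *)

Section Trajectories.
Variable V : finType.
Implicit Types (f g : {ffun V -> option V}) (u v x z : V) (i j : nat).

(** The vertex reached from [v] after [j] steps along the arcs of [f], if these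
    steps exist. *)
Definition traj f j v : option V := iter j (obind f) (Some v).

Arguments traj : simpl never.

Lemma trajS f j v : traj f j.+1 v = obind f (traj f j v).
Proof. by []. Qed.

Lemma trajSr f j v : traj f j.+1 v = obind (traj f j) (f v).
Proof.
rewrite /traj iterSr /=; case: (f v) => //= .
by elim: j => //= j ->.
Qed.

Lemma trajD f i j v : traj f (i + j) v = obind (traj f i) (traj f j v).
Proof.
elim: j v => [|j IHj] v; first by rewrite addn0.
by rewrite addnS trajSr [traj f j.+1 v]trajSr; case: (f v) => //= y.
Qed.

Lemma traj_inj f j a b z : pinj f ->
  traj f j a = Some z -> traj f j b = Some z -> a = b.
Proof.
move=> /pinjP fi; elim: j a b z => [|j IHj] a b z; first by move=> [->] [->].
rewrite !trajS; case fa: (traj f j a) => [x|] //=.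
case fb: (traj f j b) => [y|] //= fx fy.
by apply: (IHj a b x) => //; rewrite fb (fi y x z).
Qed.

Lemma traj_free f v i j x : pinj f -> free f v -> (i < j)%N ->
  traj f i v = Some x -> traj f j v <> Some x.
Proof.
move=> fi /freeP fv ij fx fj.
have E : j = (i + (j - i.+1).+1)%N by lia.
move: fj; rewrite E trajD; case fa: (traj f _ v) => [a|] //= fax.
have av := traj_inj fi fax fx; move: fa; rewrite av trajS.
by case: (traj f _ v) => //= b /fv.
Qed.

(** Changing the arc that leaves [u] does not change a trajectory before it has
    left [u]. *)
Lemma traj_agree f g u v j : (forall x, x != u -> f x = g x) ->
  (forall i, (i < j)%N -> traj f i v <> Some u) -> traj g j v = traj f j v.
Proof.
move=> fg; elim: j => // j IHj H; rewrite !trajS IHj => [|i ij]; last first.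
  by apply: H; lia.
case fj: (traj f j v) => [x|] //=; rewrite fg //.
by apply/eqP => xu; apply: (H j) => //; rewrite fj xu.
Qed.

Lemma traj_defined f v i j : (i <= j)%N -> traj f j v -> traj f i v.
Proof.
move=> ij; rewrite -(subnK ij) trajD.
by case: (traj f i v).
Qed.

End Trajectories.
Arguments traj : simpl never.

Lemma sum_indicator (I : finType) (R : realType) (P : pred I) :
  \sum_i (P i)%:R = #|[set i | P i]%SET|%:R :> R.
Proof.
rewrite -sum1_card natr_sum [RHS]big_mkcond; apply: eq_bigr => i _.
by rewrite inE; case: (P i).
Qed.

(** * Cycles in a hard-core partial injection *)

Section HardCore.
Variables (V : finType) (R : realType) (adj : rel V) (D s : nat).
Variable lam : V -> V -> R.
Implicit Types (f : {ffun V -> option V}) (u v y x : V).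
Implicit Types (Phi Psi : {ffun V -> option V} -> R) (S T : {set V}).
Hypothesis adjC : symmetric adj.
Hypothesis degD : forall u, (#|[set y | adj u y]%SET| <= D)%N.
Hypothesis s32 : (32 <= s)%N.
Let k : R := (D + s)%:R.
Hypothesis lam_ge0 : forall u v, 0 <= lam u v.
Hypothesis lam_eq0 : forall u v, ~~ adj u v -> lam u v = 0.
Hypothesis lam_arc : forall u v, adj u v ->
  k * Esum lam (fun f => (f u == Some v)%:R) = Esum lam (fun=> 1).

Let Z := Esum lam (fun=> 1).

(** The hard-core expectation of [Phi]; probabilities are expectations of
    indicators. *)
Definition Pr Phi : R := Esum lam Phi / Esum lam (fun=> 1).

Let ZE : Z = Zdel lam finset.set0 finset.set0.
Proof. by apply: eq_Esum => f _; rewrite avoids0. Qed.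

Lemma total_gt0 : 0 < Esum lam (fun=> 1).
Proof. by rewrite -/Z ZE Zdel_gt0. Qed.
Let Z0 := total_gt0.

Let s0 : 32 <= s%:R :> R. Proof. by rewrite ler_nat. Qed.
Let k0 : 0 < k. Proof. by rewrite ltr0n; lia. Qed.
Let sk : s%:R <= k. Proof. by rewrite ler_nat; lia. Qed.

Lemma eq_Pr Phi Psi : (forall f, pinj f -> Phi f = Psi f) -> Pr Phi = Pr Psi.
Proof. by move=> H; rewrite /Pr (eq_Esum _ H). Qed.

Lemma le_Pr Phi Psi : (forall f, pinj f -> Phi f <= Psi f) -> Pr Phi <= Pr Psi.
Proof. by move=> H; rewrite ler_pM2r ?invr_gt0 //; exact: le_Esum. Qed.

Lemma Pr_ge0 Phi : (forall f, pinj f -> 0 <= Phi f) -> 0 <= Pr Phi.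
Proof. by move=> H; rewrite divr_ge0 ?(ltW Z0) //; exact: Esum_ge0. Qed.

Lemma PrD Phi Psi : Pr (fun f => Phi f + Psi f) = Pr Phi + Pr Psi.
Proof. by rewrite /Pr EsumD mulrDl. Qed.

Lemma PrZ c Phi : Pr (fun f => c * Phi f) = c * Pr Phi.
Proof. by rewrite /Pr EsumZ mulrA. Qed.

Lemma Pr_sum (I : finType) (P : pred I) (F : I -> {ffun V -> option V} -> R) :
  Pr (fun f => \sum_(i | P i) F i f) = \sum_(i | P i) Pr (F i).
Proof. by rewrite /Pr Esum_sum mulr_suml. Qed.

Lemma Pr1 : Pr (fun=> 1) = 1.
Proof. by rewrite /Pr divff // gt_eqF. Qed.

Lemma Pr_insert Phi u v :
  Pr (fun f => (f u == Some v)%:R * Phi f) =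
  lam u v * Pr (fun f => ((f u == None) && free f v)%:R *
                               Phi (upd f u (Some v))).
Proof. by rewrite /Pr Esum_insert mulrA. Qed.

Lemma Pr_out Phi u :
  Pr Phi = Pr (fun f => (f u == None)%:R * Phi f) +
    \sum_v Pr (fun f => (f u == Some v)%:R * Phi f).
Proof.
rewrite /Pr (Esum_split_out lam Phi u) mulrDl; congr (_ + _).
exact: mulr_suml.
Qed.

Lemma Pr_in Phi v :
  Pr Phi = Pr (fun f => (free f v)%:R * Phi f) +
    \sum_u Pr (fun f => (f u == Some v)%:R * Phi f).
Proof.
rewrite /Pr (Esum_split_in lam Phi v) mulrDl; congr (_ + _).
exact: mulr_suml.
Qed.

Lemma Pr_arc u v : Pr (fun f => (f u == Some v)%:R) = (adj u v)%:R / k.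
Proof.
have [uv|nuv] := boolP (adj u v).
  have kN0 : k != 0 by rewrite gt_eqF.
  apply: (mulfI kN0); rewrite /Pr mulrA lam_arc // !divff ?gt_eqF //.
  by rewrite mul1r divff.
transitivity (Pr (fun f => (f u == Some v)%:R * 1)).
  by apply: eq_Pr => f _; rewrite mulr1.
by rewrite Pr_insert lam_eq0 // !mul0r.
Qed.

(** The probability that [u] is unmatched, which equals the probability that it
    is free. *)
Definition unmatched u : R := 1 - #|[set y | adj u y]%SET|%:R / k.
Local Notation del := unmatched.

Lemma Pr_None u : Pr (fun f => (f u == None)%:R) = del u.
Proof.
have := Pr_out (fun=> 1) u; rewrite Pr1.
rewrite (eq_Pr (Psi := fun f => (f u == None)%:R)) => [|f _]; last first.
  by rewrite mulr1.
rewrite (eq_bigr (fun v => (adj u v)%:R / k)) => [|v _]; last first.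
  by rewrite -Pr_arc; apply: eq_Pr => f _; rewrite mulr1.
rewrite -mulr_suml sum_indicator => E.
by apply/esym/eqP; rewrite subr_eq; apply/eqP.
Qed.

Lemma Pr_free v : Pr (fun f => (free f v)%:R) = del v.
Proof.
have := Pr_in (fun=> 1) v; rewrite Pr1.
rewrite (eq_Pr (Psi := fun f => (free f v)%:R)) => [|f _]; last first.
  by rewrite mulr1.
rewrite (eq_bigr (fun u => (adj v u)%:R / k)) => [|u _]; last first.
  by rewrite adjC -Pr_arc; apply: eq_Pr => f _; rewrite mulr1.
rewrite -mulr_suml sum_indicator => E.
by apply/esym/eqP; rewrite subr_eq; apply/eqP.
Qed.

Lemma unmatched_ge u : s%:R / k <= del u.
Proof.
rewrite /del lerBrDl -mulrDl ler_pdivrMr // mul1r -natrD ler_nat.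
by rewrite leq_add2r.
Qed.

Lemma unmatched_gt0 u : 0 < del u.
Proof.
apply: lt_le_trans (unmatched_ge u); rewrite divr_gt0 //.
by move: s0; lra.
Qed.

Lemma unmatched_le1 u : del u <= 1.
Proof. by rewrite /del lerBlDr lerDl divr_ge0 // ltW. Qed.

Let dge := unmatched_ge.
Let dgt := unmatched_gt0.
Let dle := unmatched_le1.

Lemma PrZdel S T : Pr (fun f => (avoids S T f)%:R) * Z = Zdel lam S T.
Proof. by rewrite /Pr divfK // gt_eqF. Qed.

Lemma avoids1l u f : avoids [set u]%SET finset.set0 f = (f u == None).
Proof. by rewrite -(finset.setU0 [set u]%SET) avoidsU1l avoids0 andbT. Qed.

Lemma avoids1r v f : avoids finset.set0 [set v]%SET f = free f v.
Proof. by rewrite -(finset.setU0 [set v]%SET) avoidsU1r avoids0 andbT. Qed.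

Lemma Zdel1l u : Zdel lam [set u]%SET finset.set0 = del u * Z.
Proof.
rewrite -PrZdel -Pr_None; congr (_ * _).
by apply: eq_Pr => f _; rewrite avoids1l.
Qed.

Lemma Zdel1r v : Zdel lam finset.set0 [set v]%SET = del v * Z.
Proof.
rewrite -PrZdel -Pr_free; congr (_ * _).
by apply: eq_Pr => f _; rewrite avoids1r.
Qed.

Lemma arc_Zdel u v :
  lam u v * Zdel lam [set u]%SET [set v]%SET = (adj u v)%:R / k * Z.
Proof.
have := @Zdel_insert V R lam finset.set0 finset.set0 u v.
rewrite !inE !finset.setU0 => <- //; rewrite -Pr_arc /Pr divfK ?gt_eqF //.
by apply: eq_Esum => f _; rewrite avoids0 mulr1.
Qed.

(** By positive correlation, [u] is unmatched and [v] is free with probability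
    at least [del u * del v], and inserting the arc [u -> v] multiplies this
    probability by [lam u v]. *)
Lemma activity_le u v : lam u v * (del u * del v) <= k^-1.
Proof.
have [+ _] := Zdel_correlation lam_ge0 finset.set0 finset.set0.
move=> /(_ u v); rewrite !inE !finset.setU0 -ZE Zdel1l Zdel1r => /(_ isT isT) C.
have ZZ : 0 < Z * Z by rewrite mulr_gt0.
rewrite -(ler_pM2r ZZ).
apply: le_trans (_ : lam u v * (Z * Zdel lam [set u]%SET [set v]%SET) <= _).
  by rewrite -mulrA ler_wpM2l // mulrACA.
rewrite mulrCA arc_Zdel mulrCA -[_ / k * _]mulrA.
by rewrite ler_piMl ?lern1 ?leq_b1 // mulr_ge0 ?invr_ge0 // ltW.
Qed.

Lemma activity_le_unmatched u v : lam u v <= (s%:R * del u)^-1.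
Proof.
rewrite -[leRHS]mul1r ler_pdivlMr ?mulr_gt0 //; last by move: s0; lra.
have := activity_le u v; have l0 := lam_ge0 u v.
rewrite -(ler_pM2r k0) mulVf ?gt_eqF // => H; apply: le_trans H.
rewrite -!mulrA ler_wpM2l // mulrC ler_wpM2l ?(ltW (dgt u)) //.
by rewrite -ler_pdivrMr.
Qed.

Lemma activity_le_k u v : lam u v <= k.
Proof.
apply: le_trans (activity_le_unmatched u v) _.
rewrite -[leLHS]mul1r ler_pdivrMr ?mulr_gt0 //; last by move: s0; lra.
have := dge u; rewrite ler_pdivrMr // => H.
have : 1 <= s%:R * s%:R :> R by move: s0; nra.
move=> /le_trans; apply; rewrite mulrCA ler_wpM2l //; last by rewrite mulrC.
Qed.

Lemma Pr_free2 u v : u != v ->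
  Pr (fun f => (free f u && free f v)%:R) <= del u * del v.
Proof.
move=> uv; have [_] := Zdel_correlation lam_ge0 finset.set0 finset.set0.
move=> /(_ u v); rewrite !inE !finset.setU0 -ZE !Zdel1r => /(_ isT isT uv) C.
have ZZ : 0 < Z * Z by rewrite mulr_gt0.
rewrite -(ler_pM2r ZZ) mulrA [leRHS]mulrACA.
rewrite (eq_Pr (Psi := fun f => (avoids finset.set0 (u |: [set v])%SET f)%:R)).
  by rewrite PrZdel mulrC.
by move=> f _; rewrite avoidsU1r avoids1r.
Qed.

(** The total activity of the arcs that could be inserted at an unmatched [u].
    *)
Definition free_activity u f : R := \sum_y lam u y * (free f y)%:R.
Local Notation X := free_activity.

Lemma one_sub_expR_ge (x : R) : 0 <= x <= 1 -> x / 2 <= 1 - expR (- x).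
Proof.
move=> /andP[x0 x1]; rewrite expRN.
have e1 : 1 + x <= expR x := expR_ge1Dx x.
have : (expR x)^-1 <= (1 + x)^-1 by rewrite lef_pV2 // posrE; lra.
suff : (1 + x)^-1 <= 1 - x / 2 by lra.
rewrite -[leLHS]mul1r ler_pdivrMr; nra.
Qed.

(** Given that [u] is unmatched, [free_activity u] has mean [(1 - del u) / del
    u]; it is exponentially unlikely that [u] is unmatched and [free_activity
    u] is below a quarter of this mean. *)
Lemma free_activity_tail u :
  Pr (fun f => ((f u == None) && (X u f < (1 - del u) / del u / 4))%:R) <=
  expR (- (s%:R * (1 - del u) / 4)).
Proof.
have d0 := dgt u; have sR : 0 < s%:R :> R by move: s0; lra.
(* [t] is the largest parameter for which all exponents [t * lam u y] are
   certain to be at most [1]. *)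
pose t := s%:R * del u; pose m := (1 - del u) / del u.
have t0 : 0 < t by rewrite mulr_gt0.
pose c y : R := 1 - expR (- (t * lam u y)).
have tl y : 0 <= t * lam u y <= 1.
  rewrite mulr_ge0 ?(ltW t0) //=.
  have := activity_le_unmatched u y.
  by rewrite -[leRHS]mul1r ler_pdivlMr // mulrC.
have c01 y : 0 <= c y < 1.
  rewrite subr_ge0 ltrBlDr ltrDl expR_gt0 andbT.
  by rewrite -[leRHS]expR0 ler_expR oppr_le0; case/andP: (tl y).
pose S : {set V} := [set u]%SET.
pose G f : R := (avoids S finset.set0 f)%:R *
  \prod_(y <- index_enum V) (1 - c y * (free f y)%:R).
have GE f : G f = (f u == None)%:R * expR (- (t * X u f)).
  rewrite /G avoids1l; congr (_ * _).
  rewrite mulr_sumr -sumrN expR_sum; apply: eq_bigr => y _.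
  by case: (free f y); rewrite /c ?mulr1 ?mulr0 ?oppr0 ?expR0; ring.
apply: le_trans (_ : Pr (fun f => expR (t * m / 4) * G f) <= _).
  apply: le_Pr => f _; rewrite GE; case: eqP => [_|]; last by rewrite mul0r mulr0.
  rewrite /= mul1r -expRD; case: ltP => [lt|_]; last by rewrite expR_ge0.
  rewrite -[leLHS]expR0 ler_expR -mulrA -mulrBr mulr_ge0 ?(ltW t0) //.
  by rewrite subr_ge0 ltW.
rewrite PrZ.
have uV : uniq (index_enum V).
  by rewrite /index_enum; case: index_enum_key => /=; rewrite -enumT enum_uniq.
have := @free_product_bound V R lam S (index_enum V) c lam_ge0 uV c01.
rewrite Zdel1l => B.
have rE y : lam u y * (Zdel lam S [set y]%SET / (del u * Z)) =
    (adj u y)%:R / k / del u.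
  by rewrite mulrA arc_Zdel invfM mulrACA divff ?mulr1 // gt_eqF.
have r0 y : 0 <= Zdel lam S [set y]%SET / (del u * Z).
  by rewrite divr_ge0 ?Zdel_ge0 // mulr_ge0 // ltW.
have r1 y : Zdel lam S [set y]%SET / (del u * Z) <= 1.
  rewrite ler_pdivrMr ?mulr_gt0 // mul1r -Zdel1l; apply: le_Esum => // f _.
  rewrite -(finset.setU0 [set y]%SET) avoidsU1r -mulnb natrM.
  by rewrite ler_piMl // lern1 leq_b1.
have PB : Pr G <= expR (- (t * m / 2)).
  rewrite /Pr ler_pdivrMr //; apply: le_trans B _.
  rewrite mulrAC ler_wpM2r ?(ltW Z0) //.
  apply: le_trans (_ : \prod_(y <- index_enum V)
      expR (- (t * ((adj u y)%:R / k / del u) / 2)) <= _).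
    have fac0 y : 0 <= 1 - c y * (Zdel lam S [set y]%SET / (del u * Z)).
      have /andP[cy0 cy1] := c01 y.
      by rewrite subr_ge0 mulr_ile1 ?r0 ?r1 // ltW.
    rewrite -[leRHS]mul1r; apply: ler_pM => //; first exact: ltW.
      by apply: prodr_ge0.
    apply: ler_prod => y _; rewrite fac0 /=.
    apply: le_trans
      (_ : expR (- (c y * (Zdel lam S [set y]%SET / (del u * Z)))) <= _).
      exact: expR_ge1Dx.
    rewrite ler_expR lerN2 -rE mulrA mulrAC ler_wpM2r //.
    exact: one_sub_expR_ge.
  rewrite -expR_sum sumrN ler_expR lerN2 -!mulr_suml -mulr_sumr -!mulr_suml.
  rewrite sum_indicator /m /del opprB addrC subrK.
  by rewrite !mulrA.
have := ler_wpM2l (expR_ge0 (t * m / 4)) PB => /le_trans; apply.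
rewrite -expRD ler_expR.
have -> : s%:R * (1 - del u) = t * m.
  by rewrite /t /m mulrA mulrAC -[_ * del u / _]mulrA divff ?gt_eqF // mulr1.
lra.
Qed.

Let eps : R := expR (- (s%:R / 8)).
Let eps0 : 0 <= eps. Proof. exact: expR_ge0. Qed.

Lemma Pr_Some_le (P : pred V) Phi u : (forall f, 0 <= Phi f) ->
  \sum_(y | P y) Pr (fun f => (f u == Some y)%:R * Phi f) <= Pr Phi.
Proof.
move=> Phi0; have T0 y : 0 <= Pr (fun f => (f u == Some y)%:R * Phi f).
  by apply: Pr_ge0 => f _; rewrite mulr_ge0.
rewrite (Pr_out Phi u) [X in _ <= _ + X](bigID P) /= addrCA.
rewrite -[leLHS]addr0 lerD2l addr_ge0 //.
  by apply: Pr_ge0 => f _; rewrite mulr_ge0.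
by apply: sumr_ge0.
Qed.

(** If [Phi] does not decrease when an arc from an unmatched [u] to a free
    vertex outside [T] is inserted, then [u] is unmatched on at most a fraction
    of order [del u] of [Phi], up to a negligible error. *)
Lemma stop_bound u T Phi : (#|T| <= 2)%N -> (forall f, 0 <= Phi f <= 1) ->
  (forall f y, f u = None -> free f y -> y \notin T ->
    Phi f <= Phi (upd f u (Some y))) ->
  Pr (fun f => (f u == None)%:R * Phi f) <= 16 * del u * Pr Phi + 2 * eps.
Proof.
move=> T2 Phi01 PhiU; have d0 := dgt u.
have Phi0 f : 0 <= Phi f by case/andP: (Phi01 f).
have PP0 : 0 <= Pr Phi by apply: Pr_ge0.
set P0 := Pr _.
have P00 : 0 <= P0 by apply: Pr_ge0 => f _; rewrite mulr_ge0.
(* If [del u >= 1/2] the bound is trivial. *)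
have [dlt|dge2] := ltP (del u) (2^-1); last first.
  have : P0 <= Pr Phi by apply: le_Pr => f _; rewrite ler_piMl // lern1 leq_b1.
  move: eps0; nra.
pose a := (1 - del u) / del u / 4.
have a0 : 0 < a by rewrite !divr_gt0 //; lra.
have a8 : a^-1 <= 8 * del u.
  rewrite -[leLHS]mul1r ler_pdivrMr // /a.
  have -> : 8 * del u * ((1 - del u) / del u / 4) = 2 * (1 - del u).
    by have := d0; move: (del u) => d dp; field; rewrite gt_eqF.
  by lra.
have tail : Pr (fun f => ((f u == None) && (X u f < a))%:R) <= eps.
  apply: le_trans (free_activity_tail u) _; rewrite ler_expR lerN2.
  by move: s0; nra.
(* Either [X u f >= a], and then [1 <= X u f / a], or the event of [tail] occurs. *)
have split_le : P0 <= a^-1 * (\sum_y lam u y *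
    Pr (fun f => ((f u == None) && free f y)%:R * Phi f)) + eps.
  apply: le_trans (lerD (lexx _) tail).
  rewrite -[X in _ <= X + _](_ : Pr (fun f => a^-1 * (X u f *
      ((f u == None)%:R * Phi f))) = _); last first.
    rewrite PrZ; congr (_ * _).
    under eq_bigr => y _ do rewrite -PrZ.
    rewrite -Pr_sum; apply: eq_Pr => f _; rewrite mulr_suml.
    by apply: eq_bigr => y _; rewrite -mulnb natrM; ring.
  rewrite -PrD; apply: le_Pr => f _.
  case: eqP => _ /=; last by rewrite !mul0r mulr0 mulr0 addr0.
  rewrite mul1r; have /andP[p0 p1] := Phi01 f.
  case: ltP => [_|aX] /=.
    rewrite -[leLHS]add0r lerD // mulr_ge0 ?invr_ge0 ?(ltW a0) // mulr_ge0 //.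
    by apply: sumr_ge0 => y _; rewrite mulr_ge0.
  by rewrite addr0 mulrA ler_peMl // ler_pdivlMl // mulr1.
(* For [y] outside [T] the arc [u -> y] can be inserted; each of the at most two
   vertices of [T] contributes a small multiple of [P0], absorbed at the end. *)
have sum_le : \sum_y lam u y *
    Pr (fun f => ((f u == None) && free f y)%:R * Phi f) <=
    Pr Phi + 2 * (s%:R * del u)^-1 * P0.
  rewrite (bigID (fun y => y \notin T)) /=; apply: lerD.
    apply: le_trans (Pr_Some_le (fun y => y \notin T) u Phi0).
    apply: ler_sum => y yT; rewrite Pr_insert ler_wpM2l //.
    apply: le_Pr => f _; case: eqP => [fu|] /=; last by rewrite !mul0r.
    by case: (boolP (free f y)) => fy; rewrite ?mul0r // !mul1r PhiU.
  apply: le_trans (_ : \sum_(y in T) (s%:R * del u)^-1 * P0 <= _).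
    rewrite (eq_bigl (mem T)) => [|y]; last by rewrite negbK.
    apply: ler_sum => y _; apply: ler_pM => //.
    - by apply: Pr_ge0 => f _; rewrite mulr_ge0.
    - exact: activity_le_unmatched.
    - apply: le_Pr => f _; rewrite -mulnb natrM -mulrA.
      by rewrite mulrCA ler_piMl ?mulr_ge0 // lern1 leq_b1.
  rewrite sumr_const -[leLHS]mulr_natl -mulrA ler_wpM2r ?ler_nat //.
  by rewrite mulr_ge0 // invr_ge0 mulr_ge0 // ltW.
have : P0 <= 8 * del u * (Pr Phi + 2 * (s%:R * del u)^-1 * P0) + eps.
  apply: le_trans split_le _; rewrite lerD2r; apply: ler_pM => //.
    by rewrite invr_ge0 ltW.
  apply: sumr_ge0 => y _; rewrite mulr_ge0 //.
  by apply: Pr_ge0 => f _; rewrite mulr_ge0.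
have -> : 8 * del u * (Pr Phi + 2 * (s%:R * del u)^-1 * P0) =
    8 * del u * Pr Phi + 16 * s%:R^-1 * P0.
  have sR : s%:R != 0 :> R by rewrite gt_eqF //; move: s0; lra.
  have dN : del u != 0 by rewrite gt_eqF.
  by move: (del u) dN => d dN; field; rewrite sR dN.
have : 16 * s%:R^-1 * P0 <= P0 / 2.
  rewrite mulrC ler_wpM2l // ler_pdivrMr; move: s0; lra.
move: eps0; lra.
Qed.

(** The last arc [x -> u] of the trajectory is removed and [stop_bound] is
    applied at [x]. *)
Lemma reach_bound u v j : u != v ->
  Pr (fun f => (free f v && (traj f j.+1 v == Some u))%:R) <=
  16 * del v / k + 2 * eps * k ^+ 2.
Proof.
move=> uv; have du := dgt u; have dv := dgt v.
(* Without the arc [x -> u], [u] is free and the trajectory of [v] ends at [x];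
   [v] being free, the trajectory does not visit [x] before. *)
pose Phi x f : R := [&& free f u, free f v & traj f j v == Some x]%:R.
have sum1 : \sum_x Pr (Phi x) <= del u * del v.
  apply: le_trans (Pr_free2 uv); rewrite -Pr_sum; apply: le_Pr => f _.
  rewrite /Phi; case: (free f u); last by rewrite big1.
  case: (free f v) => /=; last by rewrite big1.
  case: (traj f j v) => [x|]; last by rewrite big1.
  rewrite (bigD1 x) //= eqxx big1 ?addr0 // => y /negPf yx.
  by rewrite (inj_eq (@Some_inj _)) eq_sym yx.
apply: le_trans (_ : \sum_x lam x u *
    (16 * del x * Pr (Phi x) + 2 * eps) <= _).
  apply: le_trans (_ : \sum_x Pr (fun f => (f x == Some u)%:R *
      (free f v && (traj f j v == Some x))%:R) <= _).
    rewrite -Pr_sum; apply: le_Pr => f _.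
    case: (boolP (_ && _)) => [/andP[fv]|_]; last by rewrite sumr_ge0.
    rewrite trajS; case fj: (traj f j v) => [x|] //= fx.
    by rewrite (bigD1 x) //= fx fv eqxx mulr1 lerDl sumr_ge0.
  apply: ler_sum => x _; rewrite Pr_insert ler_wpM2l //.
  apply: le_trans (@stop_bound x [set u; v]%SET (Phi x) _ _ _).
  - apply: le_Pr => f fi; case: eqP => [fx|_] /=; last by rewrite !mul0r.
    case: (boolP (free f u)) => fu; last by rewrite mul0r mulr_ge0.
    rewrite !mul1r /Phi fu /= ler_nat; case: (boolP (free _ v)) => //= fv'.
    have fv := free_upd_Some_inv fx fv'; rewrite fv /=.
    case: eqP => //= fj; suff -> : traj f j v = Some x by rewrite eqxx.
    rewrite -fj; apply: (@traj_agree _ _ _ x).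
      by move=> z /negPf zx; rewrite updE zx.
    move=> i ij fi'; exact: (traj_free (pinj_upd_Some x fi fu) fv' ij fi' fj).
  - by rewrite cards2; case: (u != v).
  - by move=> f; rewrite /Phi ler0n lern1 leq_b1.
  - move=> f y fx fy; rewrite !inE negb_or => /andP[yu yv].
    rewrite /Phi ler_nat; case: (boolP (free f u)) => //= fu.
    case: (boolP (free f v)) => //= fv; case: eqP => //= fj.
    rewrite !free_upd_Some 1?eq_sym //=.
    suff -> : traj (upd f x (Some y)) j v = Some x by rewrite eqxx.
    rewrite -fj; apply: (@traj_agree _ _ _ x) => [z /negPf zx|i ij fi'].
      by rewrite updE zx.
    have : traj f i.+1 v by apply: (@traj_defined _ _ _ _ j) => //; rewrite fj.
    by rewrite trajS fi' /= fx.
have lk x : lam x u * del x <= (k * del u)^-1.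
  by rewrite invfM ler_pdivlMr // -mulrA; exact: activity_le.
apply: le_trans (_ : \sum_x (16 * (k * del u)^-1 * Pr (Phi x)) +
   \sum_(x in [set x | adj u x]%SET) 2 * eps * k <= _).
  rewrite [X in _ <= _ + X]big_mkcond -big_split /=; apply: ler_sum => x _.
  rewrite inE mulrDr; apply: lerD.
    rewrite -[16 * del x * _]mulrA mulrCA -[leRHS]mulrA ler_wpM2l //.
    rewrite mulrA ler_wpM2r ?lk //.
    by apply: Pr_ge0 => f _; rewrite /Phi ler0n.
  case: ifP => [_|/negbT nux]; last by rewrite lam_eq0 ?mul0r // adjC.
  by rewrite mulrC ler_wpM2l // ?mulr_ge0 // activity_le_k.
apply: lerD.
  rewrite -mulr_sumr.
  apply: le_trans (_ : 16 * (k * del u)^-1 * (del u * del v) <= _).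
    by rewrite ler_wpM2l // mulr_ge0 // invr_ge0 mulr_ge0 // ltW.
  move: (du) k0 => /gt_eqF dN /gt_eqF kN.
  rewrite le_eqVlt; apply/orP; left; apply/eqP.
  by move: (del u) (del v) k dN kN => a b c aN cN; field; rewrite aN cN.
rewrite sumr_const -[leLHS]mulr_natr -mulrA ler_wpM2l ?mulr_ge0 //.
rewrite expr2 ler_wpM2l ?(ltW k0) // ler_nat.
by apply: leq_trans (degD u) _; rewrite leq_addr.
Qed.

(** The arc [u -> v] lies in [f] on a cycle of length [j + 1]. *)
Definition closes_at u v j f : bool :=
  [&& f u == Some v, traj f j v == Some u &
      [forall i : 'I_j, traj f i v != Some u]].

Lemma cycle_bound u v j : u != v -> 34 * eps * k ^+ 5 <= 1 ->
  Pr (fun f => (closes_at u v j.+1 f)%:R) <= 257 / k ^+ 2.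
Proof.
move=> uv small; have du := dgt u; have dv := dgt v.
pose Phi f : R := (free f v && (traj f j.+1 v == Some u))%:R.
have P1 : Pr (fun f => (closes_at u v j.+1 f)%:R) <=
    lam u v * Pr (fun f => (f u == None)%:R * Phi f).
  apply: le_trans (_ : Pr (fun f => (f u == Some v)%:R *
      (closes_at u v j.+1 f)%:R) <= _).
    apply: le_Pr => f _; rewrite /closes_at.
    by case: eqP => _ /=; rewrite ?mul1r ?mul0r.
  rewrite (Pr_insert (fun f => (closes_at u v j.+1 f)%:R)) ler_wpM2l //.
  apply: le_Pr => f fi; case: eqP => [fu|_] /=; last by rewrite !mul0r.
  rewrite /Phi; case: (boolP (free f v)) => fv; last by rewrite !mul0r mulr_ge0.
  rewrite !mul1r ler_nat /closes_at; case: eqP => //= _.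
  case: eqP => //= fj; case: forallP => //= H.
  suff -> : traj f j.+1 v = Some u by rewrite eqxx.
  rewrite -fj; apply: (@traj_agree _ _ _ u).
    by move=> z /negPf zx; rewrite updE zx.
  by move=> i ij; apply/eqP; exact: (H (Ordinal ij)).
have P2 : Pr (fun f => (f u == None)%:R * Phi f) <= 16 * del u * Pr Phi + 2 * eps.
  apply: (@stop_bound u [set v]%SET Phi).
  - by rewrite cards1.
  - by move=> f; rewrite /Phi ler0n lern1 leq_b1.
  - move=> f y fu fy; rewrite !inE => yv.
    rewrite /Phi ler_nat; case: (boolP (free f v)) => //= fv; case: eqP => //= fj.
    rewrite free_upd_Some 1?eq_sym //=.
    suff -> : traj (upd f u (Some y)) j.+1 v = Some u by rewrite eqxx.
    rewrite -fj; apply: (@traj_agree _ _ _ u) => [z /negPf zx|i ij fi'].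
      by rewrite updE zx.
    have : traj f i.+1 v by apply: (@traj_defined _ _ _ _ j.+1) => //; rewrite fj.
    by rewrite trajS fi' /= fu.
have P3 : Pr Phi <= 16 * del v / k + 2 * eps * k ^+ 2 := reach_bound j uv.
have l0 := lam_ge0 u v; have lk := activity_le_k u v.
have ldd := activity_le u v; have d1 := dle u.
have k1 : 1 <= k by move: s0 sk; lra.
apply: le_trans P1 _; apply: le_trans (ler_wpM2l l0 P2) _.
apply: le_trans (_ : lam u v * (16 * del u * (16 * del v / k + 2 * eps * k ^+ 2)
    + 2 * eps) <= _).
  by rewrite ler_wpM2l // lerD2r ler_wpM2l // mulr_ge0 // ltW.
have -> : lam u v * (16 * del u * (16 * del v / k + 2 * eps * k ^+ 2) + 2 * eps)
  = 256 * (lam u v * (del u * del v)) / k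
    + 32 * (lam u v * del u) * (eps * k ^+ 2) + 2 * lam u v * eps.
  have := gt_eqF k0; move: k (lam u v) (del u) (del v) => a b c d aN.
  by field; rewrite aN.
have t1 : 256 * (lam u v * (del u * del v)) / k <= 256 / k ^+ 2.
  rewrite -[k ^+ 2]/(k * k) invfM [leRHS]mulrA ler_wpM2r ?invr_ge0 ?(ltW k0) //.
  by rewrite ler_wpM2l.
have t2 : 32 * (lam u v * del u) * (eps * k ^+ 2) <= 32 * k * (eps * k ^+ 2).
  rewrite ler_wpM2r ?mulr_ge0 ?exprn_ge0 ?(ltW k0) // ler_wpM2l //.
  by rewrite -[leRHS]mulr1; apply: ler_pM => //; exact: ltW.
have t3 : 2 * lam u v * eps <= 2 * k * (eps * k ^+ 2).
  rewrite -!mulrA ler_wpM2l //; apply: ler_pM => //.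
  by rewrite ler_peMr // exprn_ege1.
have t4 : 34 * eps * k ^+ 3 <= 1 / k ^+ 2.
  rewrite ler_pdivlMr ?exprn_gt0 // -[_ * k ^+ 3 * _]mulrA -exprD; exact: small.
have -> : 257 / k ^+ 2 = 256 / k ^+ 2 + 1 / k ^+ 2 by lra.
apply: le_trans (_ : 256 / k ^+ 2 + 34 * eps * k ^+ 3 <= _); last by lra.
apply: le_trans (lerD (lerD t1 t2) t3) _.
have -> : k ^+ 3 = k * k ^+ 2 by rewrite exprS.
by move: (k ^+ 2) => w; lra.
Qed.
End HardCore.

(** * Removing an arc from every cycle *)

Section Cycles.
Variable V : finType.
Implicit Types (f g : {ffun V -> option V}) (u v x y z : V) (i j m : nat).

(** [x] lies on a cycle of [f].  The length of a cycle is at most the number of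
    vertices, so a bounded search suffices. *)
Definition on_cycle f x : bool := [exists j : 'I_#|V|, traj f j.+1 x == Some x].

(** The vertices of the trajectory of [x].  On a cycle this is the vertex set
    of the cycle, so it is the same for all its vertices. *)
Definition orbit_set f x : {set V} :=
  [set y | [exists j : 'I_#|V|, traj f j x == Some y]]%SET.

(** [m] is the length of the cycle through [x]. *)
Definition min_period f x m : Prop :=
  [/\ (0 < m)%N, traj f m x = Some x &
      forall i, (0 < i < m)%N -> traj f i x <> Some x].

Lemma traj_split f i j x y z :
  traj f j x = Some y -> traj f (i + j) x = Some z -> traj f i y = Some z.
Proof. by move=> fy; rewrite trajD fy. Qed.

Lemma traj_join f i j x y z :
  traj f j x = Some y -> traj f i y = Some z -> traj f (i + j) x = Some z.
Proof. by move=> fy; rewrite trajD fy. Qed.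

Lemma traj_period f m x i : traj f m x = Some x ->
  traj f (i + m) x = traj f i x.
Proof. by move=> fm; rewrite trajD fm. Qed.

Lemma traj_mod f m x i : traj f m x = Some x -> traj f (i %% m) x = traj f i x.
Proof.
move=> fm; rewrite {2}(divn_eq i m); elim: (i %/ m)%N => // q IHq.
by rewrite mulSn -addnA [(m + _)%N]addnC traj_period.
Qed.

Lemma ex_min_period f x j : (0 < j)%N -> traj f j x = Some x ->
  exists m, min_period f x m.
Proof.
move=> j0 fj.
have ex : exists n, (0 < n)%N && (traj f n x == Some x).
  by exists j; rewrite j0 fj eqxx.
case: (ex_minnP ex) => m /andP[m0 /eqP fm] mmin; exists m; split=> // i.
move=> /andP[i0 im] fi; have := mmin i; rewrite i0 fi eqxx => /(_ isT); lia.
Qed.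

Lemma min_period_inj f x m i j : pinj f -> min_period f x m ->
  (i < m)%N -> (j < m)%N -> traj f i x = traj f j x -> i = j.
Proof.
move=> fi [m0 fm mmin].
wlog ij : i j / (i <= j)%N => [H im jm E|im jm E].
  by have [|/ltnW] := leqP i j => ij; [exact: H | exact/esym/H].
have [z fz] : exists z, traj f i x = Some z.
  have : traj f i x by apply: (@traj_defined _ _ _ _ m); rewrite ?fm // ltnW.
  by case: (traj f i x) => // z _; exists z.
have E' : traj f (i + (j - i)) x = Some z by rewrite subnKC // -E.
have [xx xE] : exists y, traj f (j - i) x = Some y.
  have : traj f (j - i) x.
    by apply: (@traj_defined _ _ _ _ m); rewrite ?fm //; lia.
  by case: (traj f _ x) => // y _; exists y.
have := traj_split xE E' => /(traj_inj fi)/(_ fz) xxx.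
have [//|ne] := eqVneq i j; exfalso; apply: (mmin (j - i)%N); first by lia.
by rewrite xE xxx.
Qed.

Lemma min_period_le f x m : pinj f -> min_period f x m -> (m <= #|V|)%N.
Proof.
move=> fi mp; have [m0 fm _] := mp.
pose h (i : 'I_m) := odflt x (traj f i x).
have def (i : 'I_m) : traj f i x = Some (h i).
  have : traj f i x by apply: (@traj_defined _ _ _ _ m); rewrite ?fm // ltnW.
  by rewrite /h; case: (traj f i x).
rewrite -[leqLHS]card_ord; apply: (@leq_card _ _ h) => i j hij.
by apply/val_inj/(min_period_inj fi mp) => //=; rewrite !def hij.
Qed.

Lemma on_cycleP f x : pinj f ->
  reflect (exists m, min_period f x m) (on_cycle f x).
Proof.
move=> fi; apply: (iffP existsP) => [[j /eqP fj]|[m mp]].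
  exact: ex_min_period fj.
have := min_period_le fi mp; case: mp => m0 fm _ mV.
have mV' : (m.-1 < #|V|)%N by lia.
by exists (Ordinal mV') => /=; rewrite prednK // fm.
Qed.

Lemma mem_orbit_set f x m a y : pinj f -> min_period f x m ->
  traj f a x = Some y -> y \in orbit_set f x.
Proof.
move=> fi mp; have mV := min_period_le fi mp; have [m0 fm _] := mp.
rewrite -(traj_mod _ fm) => fa; rewrite inE; apply/existsP.
have aV : (a %% m < #|V|)%N by apply: leq_trans mV; rewrite ltn_pmod.
by exists (Ordinal aV); rewrite /= fa.
Qed.

Lemma card_orbit_set f x m : pinj f -> min_period f x m ->
  #|orbit_set f x| = m.
Proof.
move=> fi mp; have [m0 fm _] := mp.
pose h (i : 'I_m) := odflt x (traj f i x).
have def (i : 'I_m) : traj f i x = Some (h i).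
  have : traj f i x by apply: (@traj_defined _ _ _ _ m); rewrite ?fm // ltnW.
  by rewrite /h; case: (traj f i x).
have -> : orbit_set f x = h @: [set: 'I_m]%SET.
  apply/setP => y; apply/idP/imsetP => [|[i _ ->]]; last first.
    exact: (mem_orbit_set fi mp (def i)).
  rewrite inE => /existsP[j /eqP]; rewrite -(traj_mod _ fm) => fj.
  exists (Ordinal (ltn_pmod j m0)) => //.
  by have := def (Ordinal (ltn_pmod j m0)); rewrite /= fj => -[].
rewrite card_imset ?cardsT ?card_ord // => i j hij.
by apply/val_inj/(min_period_inj fi mp) => //=; rewrite !def hij.
Qed.

Lemma orbit_set_eq f x m z : pinj f -> min_period f x m ->
  z \in orbit_set f x -> on_cycle f z /\ orbit_set f z = orbit_set f x.
Proof.
move=> fi mp; have [m0 fm _] := mp.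
rewrite inE => /existsP[j /eqP]; rewrite -(traj_mod _ fm).
have im := ltn_pmod j m0; move: (j %% m)%N im => i im fz.
have zm : traj f m z = Some z.
  by apply: (traj_split fz); rewrite addnC traj_period.
have [mz mpz] := ex_min_period m0 zm.
have zx : traj f (m - i) z = Some x by apply: (traj_split fz); rewrite subnK // ltnW.
split; first by apply/on_cycleP => //; exists mz.
apply/setP => y; apply/idP/idP; rewrite [in X in X -> _]inE => /existsP[a /eqP fa].
  exact: (mem_orbit_set fi mp (traj_join fz fa)).
exact: (mem_orbit_set fi mpz (traj_join zx fa)).
Qed.

(** The arc leaving [x] is removed in round [i] if [x] is the [i]-th vertex of
    its cycle, counted modulo the length of the cycle in a fixed enumeration.
    *)
Definition deleted i f x : bool :=
  on_cycle f x && (index x (enum (orbit_set f x)) == i %% #|orbit_set f x|)%N.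

(** The partial injection that is left after the removals of round [i]. *)
Definition cut i f : {ffun V -> option V} :=
  [ffun x => if deleted i f x then None else f x].

Lemma cutE i f x : cut i f x = if deleted i f x then None else f x.
Proof. by rewrite ffunE. Qed.

Lemma cut_sub i f x y : cut i f x = Some y -> f x = Some y.
Proof. by rewrite cutE; case: ifP. Qed.

Lemma pinj_cut i f : pinj f -> pinj (cut i f).
Proof.
by move=> /pinjP fi; apply/pinjP => a b y /cut_sub fa /cut_sub; exact: fi.
Qed.

Lemma traj_cut i f j x y : traj (cut i f) j x = Some y -> traj f j x = Some y.
Proof.
elim: j y => // j IHj y; rewrite !trajS.
case fz: (traj _ j x) => [z|] //= /cut_sub fy.
by rewrite (IHj z fz).
Qed.

Definition acyclic f : Prop := forall j x, (0 < j)%N -> traj f j x <> Some x.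

Lemma acyclic_cut i f : pinj f -> acyclic (cut i f).
Proof.
move=> fi j x j0 gj; set g := cut i f in gj.
have [m mp] := ex_min_period j0 (traj_cut gj).
have cm := card_orbit_set fi mp; have [m0 fm _] := mp.
set O := orbit_set f x in cm.
have iO : (i %% #|O| < #|O|)%N by rewrite ltn_pmod // cm.
(* A cycle of [cut i f] is a cycle of [f], but [z] lost its arc in round [i]. *)
pose z := nth x (enum O) (i %% #|O|).
have zO : z \in O by rewrite -mem_enum mem_nth // -cardE.
have [zc Oz] := orbit_set_eq fi mp zO.
have zdel : deleted i f z.
  by rewrite /deleted zc Oz -/O index_uniq ?enum_uniq -?cardE /=.
move: zO; rewrite inE => /existsP[a /eqP fz].
have all_def q : traj g q x.
  apply: (@traj_defined _ _ _ _ (q * j)%N); first by rewrite leq_pmulr.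
  suff -> : traj g (q * j) x = Some x by [].
  by elim: q => // q IHq; rewrite mulSn; apply: traj_join IHq gj.
have := all_def a.+1; rewrite trajS.
have := all_def a; case ga: (traj g a x) => [w|] // _ /=.
have := traj_cut ga; rewrite fz => -[<-].
by rewrite /g cutE zdel.
Qed.

Lemma count_mod (N l c : nat) : (0 < l)%N -> (l %| N)%N ->
  (\sum_(i < N) (c == i %% l) <= N %/ l)%N.
Proof.
move=> l0 /dvdnP[q ->]; rewrite mulnK //.
rewrite -(big_mkord xpredT (fun i => (c == i %% l)%N : nat)).
elim: q => [|q IHq]; first by rewrite mul0n big_geq.
rewrite mulSn addnC (@big_cat_nat _ _ _ (q * l)) ?leq_addr //= -addn1 leq_add //.
rewrite -{1}[(q * l)%N]add0n big_addn addKn.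
under eq_big_nat => i /andP[_ il] do rewrite addnC modnMDl modn_small //.
rewrite big_mkord; case: (ltnP c l) => [cl|lc].
  rewrite (bigD1 (Ordinal cl)) //= eqxx big1 // => i ic.
  by case: eqP => // E; case/eqP: ic; apply/val_inj.
by rewrite big1 // => i _; case: eqP => // E; have := ltn_ord i; lia.
Qed.

(** Over the rounds [i < n!], where [n] is the number of vertices and [n!] a
    multiple of every cycle length, each vertex of a cycle of length [m] loses
    its arc in a fraction [1/m] of the rounds. *)
Lemma count_deleted f x m : pinj f -> min_period f x m ->
  (\sum_(i < (#|V|)`!) deleted i f x <= (#|V|)`! %/ m)%N.
Proof.
move=> fi mp; rewrite /deleted (card_orbit_set fi mp).
have -> : on_cycle f x by apply/on_cycleP => //; exists m.
have mV := min_period_le fi mp; have [m0 _ _] := mp.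
by apply: count_mod => //; rewrite dvdn_fact // m0.
Qed.

(** The first vertices, at most [n + 1] of them, of the trajectory of [v]. *)
Fixpoint path_from f n v : seq V :=
  v :: (if n is n'.+1 then if f v is Some y then path_from f n' y else [::]
        else [::]).

Lemma mem_path_from f n v z : z \in path_from f n v ->
  exists2 j, (j <= n)%N & traj f j v = Some z.
Proof.
elim: n v => [|n IHn] v /=; first by rewrite inE => /eqP ->; exists 0.
rewrite inE => /orP[/eqP ->|]; first by exists 0.
case fv: (f v) => [y|] // /IHn[j jn fj].
by exists j.+1 => //; rewrite trajSr fv.
Qed.

Lemma uniq_path_from f n v : acyclic f -> uniq (path_from f n v).
Proof.
move=> fa; elim: n v => //= n IHn v; case fv: (f v) => [y|] //=.
rewrite IHn andbT; apply/negP => /mem_path_from[j _ fj].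
by apply: (fa j.+1 v) => //; rewrite trajSr fv.
Qed.

Lemma path_from_zip f n v j x y : (j < n)%N -> traj f j v = Some x ->
  f x = Some y ->
  (x, y) \in zip (path_from f n v) (behead (path_from f n v)).
Proof.
move=> + + fx; elim: n j v => // n IHn [|j] v jn.
  move=> [->] /=; rewrite fx; case: n {IHn jn} => [|n] /=;
  by rewrite inE eqxx.
rewrite trajSr /=; case fv: (f v) => [w|] //= fj.
have := IHn j w jn fj; case: n {IHn jn} => [|n] //= H.
by rewrite inE H orbT.
Qed.

Lemma size_path_from f n v : traj f n v -> size (path_from f n v) = n.+1.
Proof.
by elim: n v => //= n IHn v; rewrite trajSr; case: (f v) => //= y /IHn ->.
Qed.

(** Without cycles, following the arcs backwards from [x] ends at a free
    vertex. *)
Lemma ex_start f x : pinj f -> acyclic f ->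
  exists v j, [/\ free f v, (j < #|V|)%N & traj f j v = Some x].
Proof.
move=> fi fa; pose P j := [exists v, traj f j v == Some x].
(* [P j] says that [j] backward steps from [x] are possible. *)
have bound j : P j -> (j < #|V|)%N.
  move=> /existsP[v /eqP fj]; rewrite -(@size_path_from f j v) ?fj //.
  by rewrite -(card_uniqP (uniq_path_from j v fa)) max_card.
have ex : exists j, P j by exists 0; apply/existsP; exists x.
have [j /existsP[v /eqP fj] jmax] := ex_maxnP ex (fun j Pj => ltnW (bound j Pj)).
exists v, j; split=> //; last by apply: bound; apply/existsP; exists v; rewrite fj.
apply/freeP => u fu; have := jmax j.+1; rewrite ltnn => H; apply: notF; apply: H.
by apply/existsP; exists u; rewrite trajSr fu /= fj.
Qed.

End Cycles.

Lemma uniq_flatten_map (A B : eqType) (F : A -> seq B) (s : seq A) :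
  uniq s -> {in s, forall a, uniq (F a)} ->
  {in s &, forall a b z, z \in F a -> z \in F b -> a = b} ->
  uniq (flatten [seq F a | a <- s]).
Proof.
elim: s => //= a s IHs /andP[as_ us] uF dF; rewrite cat_uniq uF ?mem_head //=.
apply/andP; split.
  apply/hasPn => z /flatten_mapP[b bs zb]; apply/negP => za.
  have ab : a = b by apply: dF zb; rewrite ?inE ?eqxx ?bs ?orbT.
  by rewrite ab bs in as_.
apply: IHs => // [b bs|b c bs cs]; first by apply: uF; rewrite inE bs orbT.
by apply: dF; rewrite inE ?bs ?cs orbT.
Qed.

(** * Linear forests from acyclic partial injections *)

Section LinearForests.
Variable G : sgraph.
Implicit Types (f : {ffun G -> option G}) (u v x y : G).

(** The maximal directed paths of an acyclic partial injection. *)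
Definition paths_of f : seq (seq G) :=
  [seq path_from f #|G| v | v <- enum G & free f v].

(** The subgraph formed by these paths. *)
Definition forest_of f : subgraph G :=
  ([set x in flatten (paths_of f)]%SET,
   (\bigcup_(p <- paths_of f) path_edges p)%SET).

Lemma linear_forest_of f : pinj f -> acyclic f ->
  (forall u v, f u = Some v -> adj u v) -> linear_forest (forest_of f).
Proof.
move=> fi fa fadj; exists (paths_of f); split => //.
  apply/allP => p /mapP[v _ ->]; apply/andP; split; first by case: #|G|.
  elim: #|G| v => [|n IHn] v //=; case fv: (f v) => [y|] //=.
  by have := IHn y; case: n {IHn} => [|n] /=; rewrite (fadj _ _ fv).
apply: uniq_flatten_map => [|v _|a b].
- by rewrite filter_uniq // enum_uniq.
- exact: uniq_path_from.
rewrite !mem_filter => /andP[a_free _] /andP[b_free _] z.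
move=> /mem_path_from[i _ fa_i] /mem_path_from[j _ fb_j].
wlog ij : a b i j a_free b_free fa_i fb_j / (i <= j)%N => [H|].
  have [|/ltnW] := leqP i j; first exact: H fa_i fb_j.
  by move=> ji; apply/esym; apply: H fb_j fa_i ji.
have fb' : traj f (i + (j - i)) b = Some z by rewrite subnKC.
have [w fw] : exists w, traj f (j - i) b = Some w.
  have : traj f (j - i) b.
    by apply: (@traj_defined _ _ _ _ j); rewrite ?fb_j // leq_subr.
  by case: (traj f _ b) => // w _; exists w.
have wa := traj_inj fi (traj_split fw fb') fa_i; subst w.
case: (j - i)%N fw => [[->]//|n]; rewrite trajS.
by case: (traj f n b) => //= c fc; have /freeP/(_ c) := a_free; rewrite fc.
Qed.

Lemma forest_of_edge f u v : pinj f -> acyclic f -> f u = Some v ->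
  [set u; v]%SET \in (forest_of f).2.
Proof.
move=> fi fa fu; have [a [j [a_free jn fj]]] := ex_start u fi fa.
rewrite /forest_of /= (big_rem (path_from f #|G| a)) /=; last first.
  by apply: map_f; rewrite mem_filter a_free mem_enum.
rewrite inE; apply/orP; left; apply/imsetP.
by exists (u, v) => //; apply: path_from_zip jn fj fu.
Qed.

End LinearForests.

(** * The random linear forest *)

Section RandomForest.
Variables (G : sgraph) (R : realType) (D s : nat) (lam : G -> G -> R).
Implicit Types (f : {ffun G -> option G}) (u v x y : G).
Hypothesis degD : forall u : G, (#|[set y | adj u y]%SET| <= D)%N.
Hypothesis s32 : (32 <= s)%N.
Hypothesis lam_ge0 : forall u v, 0 <= lam u v.
Hypothesis lam_eq0 : forall u v, ~~ adj u v -> lam u v = 0.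
Hypothesis lam_arc : forall u v, adj u v ->
  (D + s)%:R * Esum lam (fun f => (f u == Some v)%:R) = Esum lam (fun=> 1).

Let k : R := (D + s)%:R.
Let N := (#|G|)`!.
Let N0 : 0 < N%:R :> R. Proof. by rewrite ltr0n fact_gt0. Qed.
Let k0 : 0 < k. Proof. by rewrite ltr0n; lia. Qed.

(** The law of the forest of [cut i f], for a hard-core [f] and an independent
    uniform round [i]. *)
Definition forest_dist (F : subgraph G) : R :=
  (\sum_(i < N) Pr lam (fun f => (forest_of (cut i f) == F)%:R)) / N%:R.

Lemma weight_neq0_adj f u v : weight lam f != 0 -> f u = Some v -> adj u v.
Proof.
move=> wf fu; apply: contraNT wf => nuv.
by rewrite /weight (bigD1 u) //= fu lam_eq0 // mul0r.
Qed.

Lemma forest_distP : linear_forest_dist forest_dist.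
Proof.
split=> [F||F].
- rewrite divr_ge0 ?(ltW N0) //; apply: sumr_ge0 => i _.
  by apply: (Pr_ge0 lam_ge0).
- rewrite -mulr_suml exchange_big /= (eq_bigr (fun=> 1)) => [|i _].
    by rewrite sumr_const card_ord divff // gt_eqF.
  rewrite -Pr_sum -[RHS](Pr1 lam_ge0); apply: eq_Pr => f _.
  rewrite (bigD1 (forest_of (cut i f))) //= eqxx big1 ?addr0 // => F /negPf.
  by rewrite eq_sym => ->.
move=> muF; apply: contrapT => nF; move/eqP: muF; apply.
rewrite /forest_dist big1 ?mul0r // => i _; rewrite /Pr.
rewrite (_ : Esum _ _ = 0) ?mul0r //; apply: big1 => f fi.
case: eqP => [EF|_]; last by rewrite mulr0.
have [->|wf] := eqVneq (weight lam f) 0; first by rewrite mul0r.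
case: nF; rewrite -EF; apply: linear_forest_of.
- exact: pinj_cut.
- exact: acyclic_cut.
- by move=> u v /cut_sub; exact: weight_neq0_adj.
Qed.

Lemma edge_prob_forest e :
  edge_prob forest_dist e =
  (\sum_(i < N) Pr lam (fun f => (e \in (forest_of (cut i f)).2)%:R)) / N%:R.
Proof.
rewrite /edge_prob /forest_dist -mulr_suml exchange_big /=; congr (_ / _).
apply: eq_bigr => i _; rewrite -Pr_sum; apply: eq_Pr => f _.
rewrite big_mkcond (bigD1 (forest_of (cut i f))) // big1 ?addr0.
  by rewrite eqxx /= addr0; case: ifP.
by move=> F /negPf; rewrite eq_sym => ->; case: ifP.
Qed.

(** The probability that the arc [u -> v] lies in [f] and is not removed. *)
Definition kept u v : R :=
  (\sum_(i < N) Pr lam (fun f => (cut i f u == Some v)%:R)) / N%:R.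

(** As [cut i f] is acyclic, it cannot contain both arcs of an edge, so their
    probabilities add up. *)
Lemma edge_prob_ge_kept u v :
  kept u v + kept v u <= edge_prob forest_dist [set u; v]%SET.
Proof.
rewrite edge_prob_forest /kept -mulrDl ler_pM2r ?invr_gt0 // -big_split /=.
apply: ler_sum => i _; rewrite -PrD; apply: le_Pr => // f fi.
have ci := pinj_cut i fi; have ca := acyclic_cut (i := i) fi.
case: eqP => [fu|_]; case: eqP => [fv|_]; rewrite ?addr0 ?add0r //.
- by case: (ca 2 u isT); rewrite trajSr fu /= trajS /= fv.
- by rewrite (forest_of_edge ci ca fu).
- by rewrite finset.setUC (forest_of_edge ci ca fv).
Qed.

(** Cycles with more than [L + 1] vertices are accounted for by the term [1/L].
    *)
Lemma deletion_rate f u v (L : nat) : (0 < L)%N -> pinj f -> u != v ->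
  f u = Some v ->
  (\sum_(i < N) deleted i f u)%N%:R / N%:R <=
  \sum_(j < L) (closes_at u v j.+1 f)%:R / (j.+2)%:R + L%:R^-1 :> R.
Proof.
move=> L0 fi uv fu.
have S0 : 0 <= \sum_(j < L) (closes_at u v j.+1 f)%:R / (j.+2)%:R :> R.
  by apply: sumr_ge0 => j _; rewrite divr_ge0.
have [/on_cycleP|nc] := boolP (on_cycle f u); last first.
  rewrite big1 ?mul0r ?addr_ge0 // => i _; by rewrite /deleted (negPf nc).
move=> /(_ fi)[m mp]; have [m0 fm mmin] := mp.
have rate : (\sum_(i < N) deleted i f u)%N%:R / N%:R <= m%:R^-1 :> R.
  rewrite ler_pdivrMr // ler_pdivlMl ?ltr0n // -natrM ler_nat.
  apply: leq_trans (_ : m * (N %/ m) <= _)%N.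
    by rewrite leq_mul2l count_deleted ?orbT.
  by rewrite mulnC leq_trunc_div.
apply: le_trans rate _.
case: m => [//|[|m]] in mp m0 fm mmin *.
  by move: fm; rewrite trajSr fu => -[E]; rewrite E eqxx in uv.
have [mL|Lm] := ltnP m L; last first.
  rewrite -[leLHS]add0r lerD // lef_pV2 ?posrE ?ltr0n // ler_nat; lia.
rewrite (bigD1 (Ordinal mL)) //= -addrA -[leLHS]addr0 lerD //; last first.
  by rewrite addr_ge0 // sumr_ge0 // => j _; rewrite divr_ge0.
suff -> : closes_at u v m.+1 f by rewrite mul1r.
move: fm; rewrite trajSr fu /= => fm; rewrite /closes_at fu fm !eqxx /=.
apply/forallP => j; apply/eqP => fj; apply: (mmin j.+1).
  by have := ltn_ord j; lia.
by rewrite trajSr fu.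
Qed.

Lemma kept_ge u v (L : nat) : (0 < L)%N -> adj u v ->
  34 * expR (- (s%:R / 8)) * k ^+ 5 <= 1 ->
  k^-1 - (257 / k ^+ 2 * (\sum_(j < L) (j.+2)%:R^-1) + (L%:R * k)^-1) <=
  kept u v.
Proof.
move=> L0 auv small; have uv : u != v.
  by apply: contraTneq auv => ->; rewrite adj_irrefl.
have arcP : Pr lam (fun f => (f u == Some v)%:R) = k^-1.
  by rewrite (Pr_arc s32 lam_ge0 lam_eq0 lam_arc) auv mul1r.
pose del f : R := (\sum_(i < N) deleted i f u)%N%:R / N%:R.
have keptE : kept u v = k^-1 - Pr lam (fun f => (f u == Some v)%:R * del f).
  apply/eqP; rewrite -subr_eq opprK -arcP; apply/eqP.
  rewrite /kept mulrC -Pr_sum -PrZ -PrD; apply: eq_Pr => f _.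
  case: (eqVneq (f u) (Some v)) => [fu|nfu]; last first.
    rewrite mul0r addr0 big1 ?mulr0 // => i _.
    by case: eqP => // /cut_sub fu; rewrite fu eqxx in nfu.
  rewrite mul1r /del [_%:R / _]mulrC -mulrDr natr_sum -big_split /=.
  rewrite (eq_bigr (fun=> 1)) => [|i _].
    by rewrite sumr_const card_ord mulVf // gt_eqF.
  by rewrite cutE; case: ifP => _; rewrite ?fu ?eqxx ?addr0 ?add0r.
rewrite keptE lerD2l lerN2.
apply: le_trans (_ : Pr lam (fun f =>
  \sum_(j < L) (j.+2)%:R^-1 * (closes_at u v j.+1 f)%:R +
  L%:R^-1 * (f u == Some v)%:R) <= _).
  apply: le_Pr => // f fi; case: eqP => [fu|_]; last first.
    by rewrite mul0r mulr0 addr0 sumr_ge0 // => j _; rewrite mulr_ge0.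
  rewrite mul1r mulr1; apply: le_trans (deletion_rate L0 fi uv fu) _.
  by rewrite lerD2r; apply: ler_sum => j _; rewrite mulrC.
rewrite PrD Pr_sum (PrZ lam L%:R^-1) arcP [(L%:R * k)^-1]invfM lerD2r mulr_sumr.
apply: ler_sum => j _.
rewrite PrZ mulrC ler_wpM2r //.
exact: (cycle_bound (@adj_sym G) degD s32 lam_ge0 lam_eq0 lam_arc).
Qed.

End RandomForest.

(** The dyadic bound on the harmonic sum. *)
Lemma harmonic_le (R : realType) (m : nat) :
  \sum_(j < 2 ^ m) (j.+1)%:R^-1 <= m.+1%:R :> R.
Proof.
elim: m => [|m IHm]; first by rewrite big_ord1 invr1.
rewrite -(big_mkord xpredT (fun j => (j.+1)%:R^-1)) /=.
rewrite (@big_cat_nat _ _ _ (2 ^ m)) //=; last by rewrite leq_exp2l.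
rewrite big_mkord -natr1 lerD //.
apply: le_trans (_ : \sum_(2 ^ m <= j < 2 ^ m.+1) (2 ^ m)%:R^-1 <= _).
  rewrite !big_nat; apply: ler_sum => j /andP[mj _].
  by rewrite lef_pV2 ?posrE ?ltr0n ?expn_gt0 // ler_nat ltnW.
rewrite sumr_const_nat expnS mul2n -addnn addnK -[leLHS]mulr_natr mulVf //.
Qed.

(** * Choice of the parameters *)

(** With [q] the integer part of the binary logarithm of [D] and [s = 2^14 *
    q], [k = D + s] is polynomial in [D]. *)
Lemma parameters_bound (D q : nat) : (0 < q)%N -> (D < 2 ^ q.+1)%N ->
  (D + 128 * (128 * q) <= 2 ^ (16 * q))%N.
Proof.
move=> q0 Dq.
have qq : (128 * (128 * q) <= 2 ^ (14 + q))%N.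
  have -> : (2 ^ (14 + q) = 128 * (128 * 2 ^ q))%N.
    by rewrite (expnD 2 14) (expnD 2 7 7) -mulnA.
  by rewrite !leq_mul // ltnW // ltn_expl.
apply: leq_trans (_ : 2 ^ (15 + q) <= _)%N; last by rewrite leq_exp2l //; lia.
apply: leq_trans (leq_add (ltnW Dq) qq) _.
rewrite [leqRHS](expnS 2 (14 + q)) [leqRHS]mul2n -addnn leq_add2r leq_exp2l //.
lia.
Qed.

Lemma fla_le_log (R : realType) (G : sgraph) (q : nat) :
  (0 < q)%N -> (max_degree G < 2 ^ q.+1)%N ->
  fla R G <= (max_degree G)%:R / 2 + 100 * 127 * q%:R.
Proof.
move=> q0; set D := max_degree G => Dq.
pose s := (128 * (128 * q))%N; pose k : R := (D + s)%:R.
have degD (u : G) : (#|[set y | adj u y]%SET| <= D)%N.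
  exact: (leq_bigmax (F := fun u : G => #|[set y | adj u y]%SET|)).
have degD' (u : G) : (#|[set y | adj y u]%SET| <= D)%N.
  apply: leq_trans (degD u); rewrite leq_eqVlt; apply/orP; left; apply/eqP.
  by apply: eq_card => y; rewrite !inE adj_sym.
have s32 : (32 <= s)%N by rewrite /s; lia.
have [lam [lam0 lamN lamA]] : exists lam : G -> G -> R,
  [/\ forall u v, 0 <= lam u v, forall u v, ~~ adj u v -> lam u v = 0 &
      forall u v, adj u v ->
        (D + s)%:R * Esum lam (fun f => (f u == Some v)%:R) = Esum lam (fun=> 1)].
  apply: (uniform_activities R degD degD'); lia.
have k2 : (D + s <= 2 ^ (16 * q))%N by exact: parameters_bound.
have k0 : 0 < k by rewrite ltr0n; lia.
have sE : s%:R = 128 * (128 * q%:R) :> R by rewrite /s !natrM.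
have q1 : 1 <= q%:R :> R by rewrite ler1n.
have kq : 128 * (128 * q%:R) <= k by rewrite -sE ler_nat; lia.
have small : 34 * expR (- (s%:R / 8)) * k ^+ 5 <= 1.
  rewrite mulrAC expRN ler_pdivrMr ?expR_gt0 // mul1r.
  have -> : s%:R / 8 = (16 * (128 * q))%N%:R :> R.
    by rewrite sE !natrM; lra.
  rewrite -[X in expR X]mulr1 expRM_natl.
  have e2 : 2 <= expR 1 :> R by have := expR_ge1Dx (1 : R); lra.
  apply: le_trans (_ : 2 ^+ (16 * (128 * q)) <= _); last first.
    by apply: lerXn2r; rewrite ?nnegrE ?expR_ge0.
  rewrite /k -!natrX -natrM ler_nat.
  apply: leq_trans (_ : 2 ^ 6 * (2 ^ (16 * q)) ^ 5 <= _)%N.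
    by apply: leq_mul => //; rewrite leq_exp2r.
  by rewrite -expnM -expnD leq_exp2l //; lia.
have harm : \sum_(j < D + s) (j.+2)%:R^-1 <= 17 * q%:R :> R.
  apply: le_trans (_ : \sum_(j < 2 ^ (16 * q)) (j.+1)%:R^-1 <= _).
    rewrite -!(big_mkord xpredT (fun j => (j.+1)%:R^-1)).
    rewrite -(big_mkord xpredT (fun j => (j.+2)%:R^-1)).
    rewrite [leRHS](@big_cat_nat _ _ _ (D + s)) //= -[leLHS]addr0 lerD //.
      by apply: ler_sum => j _; rewrite lef_pV2 ?posrE ?ltr0n // ler_nat.
    by apply: sumr_ge0 => j _; rewrite invr_ge0.
  apply: le_trans (harmonic_le R _) _.
  by rewrite -natr1 natrM; lra.
have keptL (u v : G) : adj u v ->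
    k^-1 - 70 * 63 * q%:R / k ^+ 2 <= kept lam u v.
  move=> uv; have L0 : (0 < D + s)%N by lia.
  apply: le_trans (kept_ge degD s32 lam0 lamN lamA L0 uv small).
  rewrite lerD2l lerN2 -/k -[k * k]/(k ^+ 2).
  rewrite -[(k ^+ 2)^-1]mul1r.
  have ik2 : 0 <= (k ^+ 2)^-1 by rewrite invr_ge0 exprn_ge0 // ltW.
  have H : 257 * \sum_(j < D + s) (j.+2)%:R^-1 + 1 <= 70 * 63 * q%:R :> R.
    by move: harm; lra.
  have := ler_wpM2r ik2 H; lra.
pose c : R := 70 * 63 * q%:R.
pose K : R := D%:R / 2 + 100 * 127 * q%:R.
have K0 : 0 < K by rewrite /K; have : 0 <= D%:R :> R by []; lra.
apply: ge_inf; first by exists 0 => x [/ltW].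
split=> //; exists (forest_dist lam); split.
  exact: (forest_distP lam0 lamN).
move=> e /imsetP[[u v]]; rewrite inE /= => uv ->.
apply: le_trans (edge_prob_ge_kept lam0 u v).
have vu : adj v u by rewrite adj_sym.
apply: le_trans (lerD (keptL u v uv) (keptL v u vu)).
rewrite -/c.
apply: le_trans (_ : 2 / (k + 2 * c) <= _).
  have kc : 0 < k + 2 * c by rewrite /c; lra.
  rewrite -[leLHS]mul1r ler_pdivrMr // mulrAC ler_pdivlMr // mul1r.
  have -> : k = D%:R + 128 * (128 * q%:R) by rewrite /k natrD sE.
  by rewrite /K /c; lra.
have kc : 0 < k + 2 * c by rewrite /c; lra.
rewrite ler_pdivrMr //.
have ck : 2 * c <= k by rewrite /c; lra.
have key (a b : R) : a != 0 ->
    (a^-1 - b / a ^+ 2 + (a^-1 - b / a ^+ 2)) * (a + 2 * b) =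
    2 + 2 * b * (a - 2 * b) / a ^+ 2 by move=> a0; field.
rewrite key ?gt_eqF //.
rewrite lerDl divr_ge0 ?exprn_ge0 ?(ltW k0) // mulr_ge0 ?subr_ge0 //.
by rewrite /c; lra.
Qed.

Theorem theorem1p3 (R : realType) :
  exists K : R, 0 < K /\
    forall G : sgraph, (2 <= max_degree G)%N ->
      fla R G <= (max_degree G)%:R / 2 + K * ln (max_degree G)%:R.
Proof.
have ln2 : 0 < ln 2 :> R by rewrite ln_gt0 // ltr1n.
exists (100 * 127 / ln 2); split; first by rewrite divr_gt0.
move=> G D2; set D := max_degree G in D2 *.
pose q := trunc_log 2 D.
have /andP[qD Dq] := trunc_log_bounds (isT : 1 < 2)%N (ltnW D2).
have q0 : (0 < q)%N by rewrite trunc_log_gt0.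
apply: le_trans (fla_le_log R q0 Dq) _; rewrite lerD2l.
rewrite -[leRHS]mulrA ler_wpM2l // mulrC ler_pdivlMr //.
have -> : q%:R * ln 2 = ln (2 ^+ q) :> R by rewrite lnXn // mulr_natl.
have D0 : 0 < D%:R :> R by rewrite ltr0n ltnW.
by rewrite ler_ln ?posrE ?exprn_gt0 // -natrX ler_nat.
Qed.
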